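(* Let $E$ be a real Banach space with a uniformly Gâteaux differentiable norm possessing uniform normal structure, let $K$ be a nonempty bounded closed convex subset of $E$, and let $T: K \to K$ be an asymptotically nonexpansive mapping with sequence $\{k_n\}$ of positive real numbers such that $k_n \to 1$ as $n \to \infty$, $\sup_{n \in \mathbb{N}} k_n \le N(E)^{1/2}$, and $F(T) \neq \emptyset$. Let $f: K \to K$ be a contraction with constant $\alpha \in [0,1)$. Let $\{a_n\} \subset (0,1)$, $\{b_n\} \subset [0,1)$, $\{c_n\} \subset (0,1)$ be real sequences with $a_n + b_n + c_n = 1$ for all $n \in \mathbb{N}$, and assume (i) $\lim_{n\to\infty} a_n = 0$; (ii) $\sum_{n=1}^\infty a_n = \infty$; (iii) $\lim_{n\to\infty} \frac{k_n^2 - 1}{a_n} = 0$. For arbitrary $x_1 \in K$, let $\{x_n\} \subset K$ be the sequence generated by the implicit iteration $$x_{n+1} = a_n f(x_n) + b_n x_n + c_n T^n\!\left(\frac{x_n + x_{n+1}}{2}\right), \quad n \in \mathbb{N},$$ and assume in addition that (iv) $\lim_{n\to\infty} \|x_n - T^n x_n\| = 0$. Then $\{x_n\}$ converges in norm to a fixed point $p$ of $T$ which is the unique solution of the variational inequality $$\langle (I - f)p, j(x - p)\rangle \ge 0 \quad \text{for all } x \in F(T).$$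
   Context: A mapping $T: K \to K$ is asymptotically nonexpansive if there is a sequence $\{k_n\}$ of positive reals with $k_n \to 1$ such that $\|T^n x - T^n y\| \le k_n \|x - y\|$ for all $x, y \in K$, $n \in \mathbb{N}$. $F(T) = \{x \in K : Tx = x\}$. A map $f$ is a contraction with constant $\alpha \in [0,1)$ if $\|f(x) - f(y)\| \le \alpha\|x - y\|$ for all $x,y$. $j = J$ denotes the normalized duality mapping $J(x) = \{g \in E^* : \langle x, g\rangle = \|x\|\|g\|,\ \|x\| = \|g\|\}$ (single-valued here since the norm is Gâteaux differentiable). For a bounded closed convex $C \subseteq E$, $d(C) = \sup\{\|x-y\| : x,y \in C\}$, $r(x,C) = \sup\{\|x-y\| : y \in C\}$, $r(C) = \inf\{r(x,C) : x \in C\}$. The normal structure coefficient is $N(E) = \inf\{ d(C)/r(C) : C \text{ bounded closed convex subset of } E, d(C) > 0\}$, and $E$ has uniform normal structure if $N(E) > 1$. *)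

(* Defs.v *)
From HB Require Import structures.
From mathcomp Require Import all_boot all_order all_algebra.
From mathcomp Require Import all_classical all_reals all_analysis.
Set Implicit Arguments. Unset Strict Implicit. Unset Printing Implicit Defensive.
Import Order.TTheory GRing.Theory Num.Theory.
Import numFieldNormedType.Exports.
Local Open Scope classical_set_scope.
Local Open Scope ring_scope.

Section Defs.
Variables (R : realType) (E : normedModType R).

Definition convex_subset (C : set E) : Prop :=
  forall x y (t : R), C x -> C y -> 0 <= t <= 1 -> C (t *: x + (1 - t) *: y).

Definition diam (C : set E) : R :=
  sup [set r | exists x y, C x /\ C y /\ r = `|x - y|].

Definition rad_at (x : E) (C : set E) : R :=
  sup [set r | exists y, C y /\ r = `|x - y|].

Definition cheb_rad (C : set E) : R :=
  inf [set r | exists x, C x /\ r = rad_at x C].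

Definition normal_structure_coef : R :=
  inf [set q | exists C : set E,
        [/\ bounded_set C, closed C, convex_subset C, 0 < diam C
          & q = diam C / cheb_rad C]].

Definition uniform_normal_structure : Prop := 1 < normal_structure_coef.

Definition unif_gateaux_norm : Prop :=
  forall y : E, `|y| = 1 -> exists L : E -> R,
    forall eps : R, 0 < eps -> exists2 delta : R, 0 < delta &
      forall x : E, `|x| = 1 -> forall t : R, 0 < `|t| < delta ->
        `|(`|x + t *: y| - `|x|) / t - L x| < eps.

Definition dual_norm (g : E -> R) : R :=
  sup [set r | exists y : E, `|y| <= 1 /\ r = `|g y|].

Definition duality_map (x : E) (g : E -> R) : Prop :=
  [/\ (forall (a : R) (u v : E), g (a *: u + v) = a * g u + g v),
      continuous g,
      g x = `|x| * dual_norm g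
    & dual_norm g = `|x| ].

Definition asymp_nonexpansive (K : set E) (T : E -> E) (k : nat -> R) : Prop :=
  forall n, (1 <= n)%N -> forall x y, K x -> K y ->
    `|iter n T x - iter n T y| <= k n * `|x - y|.

End Defs.

(* Main.v *)
(* Let J be the duality map, w_n = a_n / (1 - c_n / 2), and let phi (y) be the limsup of the w-weighted Cesaro means of |x_n - y|^2. Uniform normal structure makes decreasing sequences of bounded closed convex sets intersect, so phi has minimizers on K; iterating asymptotic centres of the orbits (T^m y) inside the set of minimizers produces a minimizer p with T p = p. Minimality gives <f p - p, J (x_n - p)> <= 0 in weighted mean along arbitrarily large times, and then the recursion for |x_n - p|^2 shows that its weighted means are small along such times. Summing up to such a time the recursion for |x_m - q|^2, where q is an approximate fixed point of T, T^2, ..., gives <f p - p, J (p - q)> >= 0 in the limit. For q a fixed point this is the variational inequality; for q = x_n it says that limsup <f p - p, J (x_n - p)> <= 0, and the recursion for |x_n - p|^2 then forces x_n -> p. *)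

Require Import Defs.
From HB Require Import structures.
From mathcomp Require Import all_boot all_order all_algebra.
From mathcomp Require Import all_classical all_reals all_analysis.
From mathcomp Require Import ring lra.
Import Order.TTheory GRing.Theory Num.Theory.
Import numFieldNormedType.Exports.
Local Open Scope classical_set_scope.
Local Open Scope ring_scope.

(** * The duality map of a uniformly Gateaux differentiable norm *)

Section DirectionalDerivative.
Set Implicit Arguments.
Unset Strict Implicit.
Unset Printing Implicit Defensive.
Variables (R : realType) (E : normedModType R).
Implicit Types (u v w z y : E) (r s t eps : R).

(** By convexity the one-sided derivative of |.|^2/2 always exists; uniform Gateaux smoothness makes
    it linear in the direction and uniformly controlled on bounded sets, so it can stand for J.
    Since phi is a limsup and not a linear functional, minimality controls the means only along
    infinitely many times N. One such N suffices: the recursion for |x_m - q|^2 summed up to N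
    involves only T q, ..., T^N q, and its conclusion on <f p - p, J (p - q)> no longer mentions N.
    So N is frozen before q varies, which is what permits q = x_n. The bound sup k_n <= N(E)^(1/2)
    enters through a constant kappa with 1/N(E) < kappa < N(E)^(-1/2): almost Chebyshev centres
    shrink diameters by kappa, iterates expand distances by at most N(E)^(1/2), and the product
    stays below 1. *)

Lemma norm_sqr_convex3 (a b c : R) u v w :
  0 <= a -> 0 <= b -> 0 <= c -> a + b + c = 1 ->
  `|a *: u + b *: v + c *: w| ^+ 2
    <= a * `|u| ^+ 2 + b * `|v| ^+ 2 + c * `|w| ^+ 2.
Proof.
move=> a0 b0 c0 abc.
have le1 : `|a *: u + b *: v + c *: w| <= a * `|u| + b * `|v| + c * `|w|.
  by do 2![rewrite (le_trans (ler_normD _ _))// normrZ (ger0_norm a0, ger0_norm b0, ger0_norm c0) ?lerD2r];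
     rewrite ?normrZ ?ger0_norm.
have p0 : 0 <= a * `|u| + b * `|v| + c * `|w| by rewrite !addr_ge0 ?mulr_ge0.
apply: (@le_trans _ _ ((a * `|u| + b * `|v| + c * `|w|) ^+ 2)).
  by rewrite ler_pXn2r ?nnegrE.
have -> : c = 1 - a - b by rewrite -abc; ring.
(* Variance identity: this sum is exactly the convexity defect of the square. *)
have : 0 <= a * b * (`|u| - `|v|) ^+ 2 + a * c * (`|u| - `|w|) ^+ 2
     + b * c * (`|v| - `|w|) ^+ 2.
  by rewrite !addr_ge0// mulr_ge0 ?sqr_ge0 ?mulr_ge0.
have -> : c = 1 - a - b by rewrite -abc; ring.
rewrite -subr_ge0 => h; rewrite -subr_ge0.
by apply: le_trans h _; rewrite le_eqVlt; apply/orP; left; apply/eqP; ring.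
Qed.

Lemma norm_sqr_convex2 s u w : 0 <= s <= 1 ->
  `|s *: u + (1 - s) *: w| ^+ 2 <= s * `|u| ^+ 2 + (1 - s) * `|w| ^+ 2.
Proof.
move=> /andP[s0 s1].
have := @norm_sqr_convex3 s (1 - s) 0 u w 0 s0; rewrite scale0r !addr0 mul0r addr0.
by apply; rewrite ?subr_ge0//; ring.
Qed.

(** Difference quotient of |.|^2/2. By convexity it is nondecreasing in [t > 0], so its infimum is
    the right derivative at 0. *)
Definition sqnorm_quot z v t : R := (`|z + t *: v| ^+ 2 - `|z| ^+ 2) / (2 * t).

(* With a Gateaux differentiable norm, [dirder z v] is [<v, J z>] for the normalized duality map [J]. *)
Definition dirder z v : R := inf [set sqnorm_quot z v t | t in [set t | 0 < t]].

(** Convexity of the squared norm at [z], which divides the segment from [z - s *: v] to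
    [z + t *: v] in the ratio s : t. *)
Lemma backward_quot_le z v s t : 0 < s -> 0 < t ->
  (`|z| ^+ 2 - `|z - s *: v| ^+ 2) / (2 * s) <= sqnorm_quot z v t.
Proof.
move=> s0 t0; have st0 : 0 < s + t by rewrite addr_gt0.
have sn : s + t != 0 by rewrite gt_eqF.
have := @norm_sqr_convex2 (s / (s + t)) (z + t *: v) (z - s *: v).
have -> : 1 - s / (s + t) = t / (s + t) by field.
have -> : (s / (s + t)) *: (z + t *: v) + (t / (s + t)) *: (z - s *: v) = z.
  rewrite !scalerDr scalerN !scalerA addrACA -scalerDl -scalerBl.
  have -> : s / (s + t) + t / (s + t) = 1 by field.
  have -> : s / (s + t) * t - t / (s + t) * s = 0 by field.
  by rewrite scale1r scale0r addr0.
move=> h; have /h {}h : 0 <= s / (s + t) <= 1.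
  by rewrite divr_ge0 ?(ltW s0) ?(ltW st0)//= ler_pdivrMr// mul1r lerDl ltW.
rewrite /sqnorm_quot ler_pdivrMr ?mulr_gt0// mulrAC ler_pdivlMr ?mulr_gt0//.
have {}h : (s + t) * `|z| ^+ 2
    <= s * `|z + t *: v| ^+ 2 + t * `|z - s *: v| ^+ 2.
  rewrite -(ler_pM2l st0) in h; apply: le_trans h _.
  by rewrite le_eqVlt; apply/orP; left; apply/eqP; field.
by lra.
Qed.

Lemma sqnorm_quot_mono z v s t : 0 < s -> s <= t ->
  sqnorm_quot z v s <= sqnorm_quot z v t.
Proof.
move=> s0 st; have t0 : 0 < t := lt_le_trans s0 st.
have tn : t != 0 by rewrite gt_eqF.
have := @norm_sqr_convex2 (s / t) (z + t *: v) z.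
have -> : (s / t) *: (z + t *: v) + (1 - s / t) *: z = z + s *: v.
  by rewrite scalerDr scalerBl scale1r addrAC [_ *: z + _]addrC subrK scalerA divfK.
move=> h; have /h {}h : 0 <= s / t <= 1.
  by rewrite divr_ge0 ?(ltW s0) ?(ltW t0)//= ler_pdivrMr// mul1r.
rewrite /sqnorm_quot ler_pdivrMr ?mulr_gt0// mulrAC ler_pdivlMr ?mulr_gt0//.
have {}h : t * `|z + s *: v| ^+ 2
    <= s * `|z + t *: v| ^+ 2 + (t - s) * `|z| ^+ 2.
  rewrite -(ler_pM2l t0) in h; apply: le_trans h _.
  by rewrite le_eqVlt; apply/orP; left; apply/eqP; field.
by lra.
Qed.

Lemma dirder_ge z v s : 0 < s ->
  (`|z| ^+ 2 - `|z - s *: v| ^+ 2) / (2 * s) <= dirder z v.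
Proof.
move=> s0; apply: lb_le_inf.
  by exists (sqnorm_quot z v 1), 1 => //=; exact: ltr01.
by move=> _ [t /= t0 <-]; exact: backward_quot_le.
Qed.

Lemma dirder_has_inf z v :
  has_inf [set sqnorm_quot z v t | t in [set t | 0 < t]].
Proof.
split; first by exists (sqnorm_quot z v 1), 1 => //=; exact: ltr01.
exists ((`|z| ^+ 2 - `|z - 1 *: v| ^+ 2) / (2 * 1)) => _ [t /= t0 <-].
exact: backward_quot_le.
Qed.

Lemma dirder_le z v t : 0 < t -> dirder z v <= sqnorm_quot z v t.
Proof.
by move=> t0; apply: ge_inf; [case: (dirder_has_inf z v)|exists t].
Qed.

Lemma dirder_approx z v eps : 0 < eps ->
  exists2 t, 0 < t & sqnorm_quot z v t < dirder z v + eps.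
Proof.
by move=> e0; have [_ [t t0 <-] lt] := inf_adherent e0 (dirder_has_inf z v); exists t.
Qed.

(** The subgradient inequality at the endpoint [z + v]; it extracts the viscosity term in the
    recursions for the iterates. *)
Lemma sqnormD_dirder z v : `|z + v| ^+ 2 <= `|z| ^+ 2 + 2 * dirder (z + v) v.
Proof.
by have := dirder_ge (z + v) v ltr01; rewrite scale1r addrK mulr1; lra.
Qed.

Lemma dirderZ (c : R) z v : 0 < c -> dirder z (c *: v) = c * dirder z v.
Proof.
move=> c0; have cn : c != 0 by rewrite gt_eqF.
have quotZ t : 0 < t -> sqnorm_quot z (c *: v) t = c * sqnorm_quot z v (t * c).
  by move=> t0; rewrite /sqnorm_quot scalerA; field; rewrite cn gt_eqF.
apply/eqP; rewrite eq_le; apply/andP; split; apply/ler_addgt0Pr => e e0.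
  have ec0 : 0 < e / c by rewrite divr_gt0.
  have [t t0 lt] := dirder_approx z v ec0.
  have tc0 : 0 < t / c by rewrite divr_gt0.
  apply: (le_trans (dirder_le _ _ tc0)); rewrite quotZ// divfK//.
  by rewrite -(ltr_pM2l c0) mulrDr [c * (e / c)]mulrC divfK// in lt; exact: ltW.
have [t t0 /ltW le] := dirder_approx z (c *: v) e0; apply: le_trans le.
by rewrite quotZ// ler_pM2l// dirder_le// mulr_gt0.
Qed.

(** With a common step [m], the midpoint of [z + m *: v] and [z + m *: w] is
    [z + (m / 2) *: (v + w)]; monotonicity of the quotients allows passing to the smaller step. *)
Lemma dirderD z v w : dirder z (v + w) <= dirder z v + dirder z w.
Proof.
apply/ler_addgt0Pr => e e0; have e20 : 0 < e / 2 by lra.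
have [t t0 lt] := dirder_approx z v e20.
have [s s0 ls] := dirder_approx z w e20.
pose m := Num.min t s; have m0 : 0 < m by rewrite lt_min t0.
have qv : sqnorm_quot z v m <= sqnorm_quot z v t.
  by rewrite sqnorm_quot_mono// ge_min lexx.
have qw : sqnorm_quot z w m <= sqnorm_quot z w s.
  by rewrite sqnorm_quot_mono// ge_min lexx orbT.
have m20 : 0 < m / 2 by lra.
have := dirder_le z (v + w) m20.
suff : sqnorm_quot z (v + w) (m / 2) <= sqnorm_quot z v m + sqnorm_quot z w m by lra.
have h12 : 0 <= (2^-1 : R) <= 1 by lra.
have := norm_sqr_convex2 (z + m *: v) (z + m *: w) h12.
have -> : 1 - 2^-1 = 2^-1 :> R by field.
have -> : 2^-1 *: (z + m *: v) + 2^-1 *: (z + m *: w) = z + (m / 2) *: (v + w).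
  rewrite -scalerDr addrACA -[m *: v + _]scalerDr -mulr2n -[z *+ 2]scaler_nat [2^-1 *: (_ + _)]scalerDr.
  by rewrite !scalerA mulVf ?pnatr_eq0// scale1r [2^-1 * m]mulrC.
rewrite /sqnorm_quot => h; rewrite -mulrDl.
have -> : 2 * (m / 2) = m by field.
rewrite ler_pdivrMr// mulrAC ler_pdivlMr ?mulr_gt0//.
by rewrite -(ler_pM2l m0) in h; lra.
Qed.

Lemma dirder_le_norm z v : dirder z v <= `|z| * `|v|.
Proof.
apply/ler_addgt0Pr => e e0.
pose q := `|v| ^+ 2 + 1; have q0 : 0 < q by rewrite ltr_pwDr// sqr_ge0.
have [t t0 te] : exists2 t, 0 < t & t * q = e.
  by exists (e / q); rewrite ?divr_gt0// divfK// gt_eqF.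
apply: (le_trans (dirder_le _ _ t0)).
rewrite /sqnorm_quot ler_pdivrMr ?mulr_gt0//.
have le1 : `|z + t *: v| <= `|z| + t * `|v|.
  by rewrite (le_trans (ler_normD _ _))// normrZ gtr0_norm.
have le2 : `|z + t *: v| ^+ 2 <= (`|z| + t * `|v|) ^+ 2.
  by rewrite ler_pXn2r ?nnegrE// addr_ge0// mulr_ge0// ltW.
have tv : t * `|v| ^+ 2 <= e.
  by rewrite -te ler_pM2l// /q lerDl.
have : t * (t * `|v| ^+ 2) <= t * e by rewrite ler_pM2l.
have : 0 <= t * e by rewrite mulr_ge0 ?ltW.
by move: le2; rewrite !expr2; lra.
Qed.

Lemma dirder0 z : dirder z 0 = 0.
Proof.
apply/eqP; rewrite eq_le; apply/andP; split.
  by have := dirder_le_norm z 0; rewrite normr0 mulr0.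
by have := dirder_ge z 0 ltr01; rewrite scaler0 subr0 subrr mul0r.
Qed.

Lemma dirder_ge_norm z v : - (`|z| * `|v|) <= dirder z v.
Proof.
have := dirderD z v (- v); rewrite subrr dirder0.
by have := dirder_le_norm z (- v); rewrite normrN; lra.
Qed.

Lemma dirder_self z : dirder z z = `|z| ^+ 2.
Proof.
apply/eqP; rewrite eq_le; apply/andP; split.
  by have := dirder_le_norm z z; rewrite expr2.
apply/ler_addgt0Pr => e e0.
pose q := `|z| ^+ 2 + 1; have q0 : 0 < q by rewrite ltr_pwDr// sqr_ge0.
pose s := Num.min 1 (e / q).
have s0 : 0 < s by rewrite lt_min ltr01 divr_gt0.
have s1 : s <= 1 by rewrite ge_min lexx.
have := dirder_ge z z s0.
have -> : `|z - s *: z| = (1 - s) * `|z|.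
  by rewrite -{1}(scale1r z) -scalerBl normrZ ger0_norm ?subr_ge0.
have -> : (`|z| ^+ 2 - ((1 - s) * `|z|) ^+ 2) / (2 * s) =
   `|z| ^+ 2 - s * `|z| ^+ 2 / 2 by field; rewrite gt_eqF.
have le1 : s * `|z| ^+ 2 <= e.
  apply: (@le_trans _ _ (e / q * q)); last by rewrite divfK// gt_eqF.
  by apply: ler_pM; rewrite ?sqr_ge0 ?(ltW s0)// ?ge_min ?lexx ?orbT// /q lerDl.
have : 0 <= s * `|z| ^+ 2 by rewrite mulr_ge0 ?sqr_ge0 ?ltW.
by lra.
Qed.

(** * Consequences of uniform Gateaux smoothness *)

Hypothesis smooth : unif_gateaux_norm E.

(** Smoothness is uniform on the unit sphere only. Points of norm above [rho] are rescaled to the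
    sphere; for smaller ones the cross term |z| |v| is itself small. *)
Lemma unif_smooth v r eps : 0 < eps -> exists2 t0, 0 < t0 &
  forall t z, 0 < t <= t0 -> `|z| <= r ->
    `|z + t *: v| ^+ 2 + `|z - t *: v| ^+ 2 - 2 * `|z| ^+ 2 <= eps * t.
Proof.
move=> e0; have [->|v0] := eqVneq v 0.
  exists 1 => // t z /andP[t0 _] _; rewrite scaler0 subr0 addr0.
  by have : 0 < eps * t := mulr_gt0 e0 t0; lra.
have V0 : 0 < `|v| by rewrite normr_gt0.
have Vn : `|v| != 0 by rewrite gt_eqF.
have y1 : `| `|v|^-1 *: v | = 1 by rewrite normrZ normfV normr_id mulVf.
have [L HL] := smooth y1.
pose eta := eps / (8 * `|v| * (`|r| + 1)).
have r10 : 0 < `|r| + 1 by rewrite ltr_pwDr.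
have eta0 : 0 < eta by rewrite divr_gt0// !mulr_gt0.
have [d d0 {}HL] := HL _ eta0.
pose rho := eps / (8 * `|v|); have rho0 : 0 < rho by rewrite divr_gt0// mulr_gt0.
(* The first bound keeps the rescaled step t |v| / |z| below [d] when |z| > [rho]; the second makes
   t |v|^2 at most [eps / 4]. *)
pose t0 := Num.min (d * rho / (2 * `|v|)) (eps / (4 * `|v| ^+ 2)).
exists t0.
  rewrite /t0 lt_min; apply/andP; split; apply: divr_gt0 => //.
  - exact: mulr_gt0.
  - by rewrite mulr_gt0.
  - by rewrite mulr_gt0 ?exprn_gt0.
move=> t z /andP[tp]; rewrite le_min => /andP[t1 t2] zr.
have tV : t * `|v| ^+ 2 <= eps / 4.
  move: t2; rewrite !ler_pdivlMr ?mulr_gt0 ?exprn_gt0//; lra.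
have le4 : t * (t * `|v| ^+ 2) <= t * (eps / 4) by rewrite ler_pM2l.
have [zs|zl] := leP `|z| rho.
  have tvE : `|t *: v| = t * `|v| by rewrite normrZ gtr0_norm.
  have tv0 : 0 <= t * `|v| by rewrite mulr_ge0// ltW.
  have h1 : `|z + t *: v| ^+ 2 <= (`|z| + t * `|v|) ^+ 2.
    by rewrite ler_pXn2r ?nnegrE ?addr_ge0// -tvE ler_normD.
  have h2 : `|z - t *: v| ^+ 2 <= (`|z| + t * `|v|) ^+ 2.
    by rewrite ler_pXn2r ?nnegrE ?addr_ge0// -tvE ler_normB.
  have zv : `|z| * `|v| <= eps / 8.
    apply: (@le_trans _ _ (rho * `|v|)); first by rewrite ler_pM2r.
    by rewrite /rho le_eqVlt; apply/orP; left; apply/eqP; field.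
  have : t * (`|z| * `|v|) <= t * (eps / 8) by rewrite ler_pM2l.
  by move: h1 h2 le4; rewrite !expr2; lra.
have z0 : 0 < `|z| := lt_trans rho0 zl.
have zn : `|z| != 0 by rewrite gt_eqF.
pose x := `|z|^-1 *: z; pose y := `|v|^-1 *: v; pose s := t * `|v| / `|z|.
have x1 : `|x| = 1 by rewrite normrZ normfV normr_id mulVf.
have s0 : 0 < s by rewrite divr_gt0// mulr_gt0.
have sd : s < d.
  rewrite ltr_pdivrMr//.
  apply: (@le_lt_trans _ _ (d * rho / 2)).
    by move: t1; rewrite !ler_pdivlMr ?mulr_gt0//; lra.
  by apply: (@lt_trans _ _ (d * rho)); rewrite ?ltr_pM2l//; have := mulr_gt0 d0 rho0; lra.
have zE : `|z| *: x = z by rewrite /x scalerA divff// scale1r.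
have tvE : `|z| *: (s *: y) = t *: v.
  by rewrite /s /y !scalerA; congr (_ *: _); field; rewrite zn Vn.
have pE : `|z + t *: v| = `|z| * `|x + s *: y|.
  by rewrite -{1}zE -tvE -scalerDr normrZ normr_id.
have mE : `|z - t *: v| = `|z| * `|x - s *: y|.
  by rewrite -{1}zE -tvE -scalerBr normrZ normr_id.
have sp : 0 < `|s| < d by rewrite gtr0_norm// s0.
have sm : 0 < `|- s| < d by rewrite normrN gtr0_norm// s0.
(* Quotients at [s] and [- s]: the derivative [L x] cancels in the sum of [A - 1] and [B - 1]. *)
have := HL x x1 s sp; have := HL x x1 (- s) sm.
rewrite scaleNr !ltr_norml x1 -/y => /andP[hm _] /andP[_ hp].
set A := `|x + s *: y|; set B := `|x - s *: y|.
have {hp} hp : A - 1 < s * (eta + L x).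
  by move: hp; rewrite ltrBlDr ltr_pdivrMr// mulrC.
have {hm} hm : B - 1 < s * (eta - L x).
  have : (B - 1) / s < eta - L x by move: hm; rewrite -/B invrN mulrN; lra.
  by rewrite ltr_pdivrMr// mulrC.
have hA : `|A - 1| <= s.
  rewrite -x1; apply: (le_trans (ler_dist_dist _ _)).
  by rewrite addrAC subrr add0r normrZ y1 mulr1 gtr0_norm.
have hB : `|B - 1| <= s.
  rewrite -x1; apply: (le_trans (ler_dist_dist _ _)).
  by rewrite addrAC subrr add0r normrN normrZ y1 mulr1 gtr0_norm.
have sqA : (A - 1) ^+ 2 <= s ^+ 2.
  by rewrite -real_normK ?num_real// ler_pXn2r ?nnegrE// ltW.
have sqB : (B - 1) ^+ 2 <= s ^+ 2.
  by rewrite -real_normK ?num_real// ler_pXn2r ?nnegrE// ltW.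
have AB : A ^+ 2 + B ^+ 2 - 2 <= 4 * (s * eta) + 2 * s ^+ 2.
  by move: sqA sqB hp hm; rewrite !expr2; lra.
have zs : `|z| * s = t * `|v| by rewrite /s mulrC divfK.
have etav : eta * `|v| * `|z| <= eps / 8.
  apply: (@le_trans _ _ (eta * `|v| * (`|r| + 1))).
    rewrite (ler_pM2l (mulr_gt0 eta0 V0)); apply: (le_trans zr).
    by rewrite (le_trans (ler_norm r))// lerDl.
  by rewrite /eta le_eqVlt; apply/orP; left; apply/eqP; field; rewrite Vn gt_eqF.
rewrite pE mE -/A -/B !exprMn.
have : `|z| ^+ 2 * (A ^+ 2 + B ^+ 2 - 2)
    <= `|z| ^+ 2 * (4 * (s * eta) + 2 * s ^+ 2) by rewrite ler_pM2l ?exprn_gt0.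
have -> : `|z| ^+ 2 * (4 * (s * eta) + 2 * s ^+ 2)
    = 4 * (eta * `|z| * (`|z| * s)) + 2 * (`|z| * s) ^+ 2 by ring.
rewrite zs.
have : t * (eta * `|v| * `|z|) <= t * (eps / 8) by rewrite ler_pM2l.
move: le4; rewrite !expr2; lra.
Qed.

Lemma dirder_oppl z v : dirder (- z) v = dirder z (- v).
Proof.
rewrite /dirder; congr inf; apply: eq_imagel => t _.
by rewrite /sqnorm_quot scalerN -[- z + _]opprK opprD opprK !normrN.
Qed.

(** The backward quotient lies below the derivative, and [unif_smooth] bounds the gap between
    forward and backward quotients uniformly in [z]. *)
Lemma dirder_quot v r eps : 0 < eps -> exists2 t, 0 < t &
  forall z, `|z| <= r -> sqnorm_quot z v t <= dirder z v + eps.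
Proof.
move=> e0; have [t t0 Ht] := unif_smooth v r e0; exists t => // z zr.
have tt : 0 < t <= t by rewrite t0 lexx.
have := Ht t z tt zr; have := dirder_ge z v t0.
rewrite /sqnorm_quot !ler_pdivrMr ?mulr_gt0//.
have : 0 <= eps * t by rewrite mulr_ge0// ltW.
by lra.
Qed.

Lemma dirderN z v : dirder z (- v) = - dirder z v.
Proof.
apply/eqP; rewrite eq_le; apply/andP; split; last first.
  by have := dirderD z v (- v); rewrite subrr dirder0; lra.
apply/ler_addgt0Pr => e e0.
have [m m0 Hm] := unif_smooth v `|z| e0.
have mm : 0 < m <= m by rewrite m0 lexx.
have h1 := Hm m z mm (lexx _).
have := dirder_le z v m0; have := dirder_le z (- v) m0.
rewrite /sqnorm_quot scalerN !ler_pdivlMr ?mulr_gt0// => h2 h3.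
have em : 0 <= e * m by rewrite mulr_ge0 ?ltW.
by rewrite -(ler_pM2r m0); lra.
Qed.

(** Smoothness makes the derivative odd in the direction, and an odd subadditive function is
    additive. *)
Lemma dirder_linear z (c : R) v w :
  dirder z (c *: v + w) = c * dirder z v + dirder z w.
Proof.
have dD a b : dirder z (a + b) = dirder z a + dirder z b.
  apply/eqP; rewrite eq_le dirderD/=.
  by have := dirderD z (- a) (- b); rewrite -opprD !dirderN; lra.
rewrite dD; congr (_ + _).
have [c0|c0|->] := ltrgt0P c; last by rewrite scale0r dirder0 mul0r.
  by rewrite dirderZ.
have := @dirderZ (- c) z v; rewrite scaleNr dirderN oppr_gt0 => /(_ c0).
by rewrite mulNr => /oppr_inj.
Qed.

(** For one fixed step the quotient is Lipschitz in its base point on a ball. This is the uniform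
    norm-to-weak* continuity of the duality map, put as a Lipschitz bound plus [eps] so that it can
    be summed with weights. *)
Lemma dirder_lip v r eps : 0 < eps -> exists2 C, 0 <= C &
  forall y z, `|y| <= r -> `|z| <= r ->
    dirder z v <= dirder y v + eps + C * `|z - y|.
Proof.
move=> e0; have [t t0 Ht] := dirder_quot v r e0.
pose M := 2 * `|r| + t * `|v|.
have M0 : 0 <= M by rewrite addr_ge0 ?mulr_ge0// ltW.
exists (2 * M / t); first by rewrite divr_ge0 ?mulr_ge0 ?(ltW t0).
move=> y z yr zr.
have zr' := le_trans zr (ler_norm r); have yr' := le_trans yr (ler_norm r).
have sq_dist (a b m : R) : 0 <= a -> 0 <= b -> a <= m -> b <= m -> 0 <= m ->
    a ^+ 2 - b ^+ 2 <= 2 * m * `|a - b|.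
  move=> a0 b0 am bm m0; rewrite subr_sqr mulrC.
  apply: (@le_trans _ _ ((a + b) * `|a - b|)).
    by rewrite ler_wpM2l ?addr_ge0// ler_norm.
  by rewrite ler_wpM2r//; lra.
have tvE : `|t *: v| = t * `|v| by rewrite normrZ gtr0_norm.
have tv0 : 0 <= t * `|v| by rewrite mulr_ge0// ltW.
have r0 := normr_ge0 r.
have h1 : `|z + t *: v| ^+ 2 - `|y + t *: v| ^+ 2 <= 2 * M * `|z - y|.
  apply: le_trans (sq_dist _ _ M _ _ _ _ M0) _; rewrite ?normr_ge0//.
  - by rewrite (le_trans (ler_normD _ _))// tvE /M; lra.
  - by rewrite (le_trans (ler_normD _ _))// tvE /M; lra.
  - rewrite ler_wpM2l ?mulr_ge0//; apply: (le_trans (ler_dist_dist _ _)).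
    by rewrite opprD addrACA subrr addr0.
have h2 : `|y| ^+ 2 - `|z| ^+ 2 <= 2 * M * `|z - y|.
  apply: le_trans (sq_dist _ _ M _ _ _ _ M0) _; rewrite ?normr_ge0//.
  - by rewrite /M; lra.
  - by rewrite /M; lra.
  - rewrite ler_wpM2l ?mulr_ge0//; apply: (le_trans (ler_dist_dist _ _)).
    by rewrite distrC.
apply: (le_trans (dirder_le z v t0)); apply: (@le_trans _ _ (sqnorm_quot y v t + 2 * M / t * `|z - y|)).
  rewrite /sqnorm_quot -subr_ge0.
  have -> : (`|y + t *: v| ^+ 2 - `|y| ^+ 2) / (2 * t) + 2 * M / t * `|z - y|
    - (`|z + t *: v| ^+ 2 - `|z| ^+ 2) / (2 * t)
    = ((2 * M * `|z - y| - (`|z + t *: v| ^+ 2 - `|y + t *: v| ^+ 2))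
     + (2 * M * `|z - y| - (`|y| ^+ 2 - `|z| ^+ 2))) / (2 * t) by field; rewrite gt_eqF.
  apply: divr_ge0; last by rewrite mulr_ge0// ltW.
  by apply: addr_ge0; rewrite subr_ge0.
by rewrite lerD2r Ht.
Qed.

Lemma dirder_duality_map z : duality_map z (dirder z).
Proof.
have bound u : `|dirder z u| <= `|z| * `|u|.
  by rewrite ler_norml dirder_ge_norm dirder_le_norm.
have dn : dual_norm (dirder z) = `|z|.
  apply/eqP; rewrite eq_le; apply/andP; split.
    apply: ge_sup; first by exists `|dirder z 0|, 0; rewrite normr0.
    by move=> _ [y [y1 ->]]; apply: (le_trans (bound y)); rewrite ler_piMr.
  apply: ub_le_sup.
    by exists `|z| => _ [y [y1 ->]]; apply: (le_trans (bound y)); rewrite ler_piMr.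
  have [->|z0] := eqVneq z 0.
    by exists 0; rewrite dirder0 !normr0.
  exists (`|z|^-1 *: z); split.
    by rewrite normrZ normfV normr_id mulVf ?normr_eq0.
  rewrite dirderZ ?invr_gt0 ?normr_gt0// dirder_self expr2 mulKf ?normr_eq0//.
  by rewrite normr_id.
split=> //; last by rewrite dn dirder_self expr2.
- exact: dirder_linear.
- move=> u; apply/cvgrPdist_lt => e e0.
  have d0 : 0 < e / (`|z| + 1) by rewrite divr_gt0// ltr_pwDr.
  near=> w.
  have -> : dirder z u - dirder z w = dirder z (u - w).
    by rewrite [u - w]addrC -[- w]scaleN1r dirder_linear mulN1r addrC.
  apply: (le_lt_trans (bound _)).
  apply: (@le_lt_trans _ _ ((`|z| + 1) * `|u - w|)).
    by rewrite ler_wpM2r// lerDl.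
  rewrite -ltr_pdivlMl ?ltr_pwDr// mulrC.
  by near: w; apply: cvgr_dist_lt.
Unshelve. all: by end_near. Qed.


Lemma duality_map_le_norm z (g : E -> R) v : duality_map z g -> g v <= `|z| * `|v|.
Proof.
move=> [glin gcont gz gn].
have g0 : g 0 = 0 by have := glin 1 0 0; rewrite scale1r add0r mul1r; lra.
have gZ (s : R) u : g (s *: u) = s * g u.
  by have := glin s u 0; rewrite addr0 g0 addr0.
have [d d0 Hd] : exists2 d : R, 0 < d & forall u, `|u| < d -> `|g u| < 1.
  have /cvgrPdist_lt/(_ 1 ltr01) := gcont 0.
  rewrite g0 => /nbhs_ballP[d /= d0 Hd]; exists d => // u ud.
  by have := Hd u; rewrite -ball_normE /= sub0r normrN sub0r normrN; apply.
(* [dual_norm] is a real [sup], meaningful only for a bounded set; continuity at 0 supplies the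
   bound. *)
have gub : has_ubound [set r | exists y, `|y| <= 1 /\ r = `|g y|].
  exists (2 / d) => _ [u [u1 ->]].
  have : `|g ((d / 2) *: u)| < 1.
    apply: Hd; rewrite normrZ gtr0_norm ?divr_gt0//.
    by apply: (@le_lt_trans _ _ (d / 2)); [rewrite ler_piMr// divr_ge0 ?ltW|lra].
  rewrite gZ normrM gtr0_norm ?divr_gt0// => /ltW.
  by rewrite -ler_pdivlMl ?divr_gt0// invf_div mulr1.
have [->|v0] := eqVneq v 0; first by rewrite g0 normr0 mulr0.
have V0 : 0 < `|v| by rewrite normr_gt0.
have : `|g (`|v|^-1 *: v)| <= `|z|.
  rewrite -gn; apply: ub_le_sup => //; exists (`|v|^-1 *: v); split => //.
  by rewrite normrZ normfV normr_id mulVf ?gt_eqF.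
rewrite gZ normrM normfV normr_id ler_pdivrMl// mulrC => le.
by rewrite (le_trans (ler_norm _)).
Qed.

(** A duality functional is a subgradient of |.|^2/2: g (z + t v) <= |z| |z + t v| <= (|z|^2 + |z +
    t v|^2) / 2, while g z = |z|^2. *)
Lemma duality_map_le_dirder z (g : E -> R) v : duality_map z g -> g v <= dirder z v.
Proof.
move=> dg; have [glin _ gz gn] := dg.
apply: lb_le_inf; first by exists (sqnorm_quot z v 1), 1 => //=; exact: ltr01.
move=> _ [t /= t0 <-]; rewrite ler_pdivlMr ?mulr_gt0//.
have := duality_map_le_norm (t *: v + z) dg; rewrite glin gz gn [t *: v + z]addrC.
have := sqr_ge0 (`|z + t *: v| - `|z|); rewrite !expr2; lra.
Qed.

End DirectionalDerivative.

(** * Uniform normal structure *)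

Section ClosedConvexHull.
Set Implicit Arguments.
Unset Strict Implicit.
Unset Printing Implicit Defensive.
Variables (R : realType) (E : normedModType R).
Implicit Types (A C : set E) (s : nat -> E).

Definition closed_convex_hull A : set E :=
  smallest (fun C => closed C /\ convex_subset C) A.

Lemma closed_closed_convex_hull A : closed (closed_convex_hull A).
Proof. by apply: closed_bigI => C [[]]. Qed.

Lemma convex_closed_convex_hull A : convex_subset (closed_convex_hull A).
Proof.
move=> u v t hu hv t01 C CA; have [[_ cC] _] := CA.
by apply: cC => //; [exact: hu|exact: hv].
Qed.

Lemma closed_convex_hull_sub A C :
  closed C -> convex_subset C -> A `<=` C -> closed_convex_hull A `<=` C.
Proof. by move=> cC vC; apply: smallest_sub. Qed.

Lemma closed_sublevel (f : E -> R) r : continuous f -> closed [set y | f y <= r].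
Proof.
move=> cf; rewrite (_ : [set y | _] = f @^-1` [set t | t <= r])//.
by apply: preimage_closed => [y _|]; [exact: cf|exact: closed_le].
Qed.

Lemma continuous_dist c : continuous (fun y : E => `|c - y|).
Proof.
by move=> y; apply: cvg_norm; apply: cvgB; [exact: cvg_cst|exact: cvg_id].
Qed.

Lemma dist_convex (c u v : E) (t : R) : 0 <= t <= 1 ->
  `|c - (t *: u + (1 - t) *: v)| <= t * `|c - u| + (1 - t) * `|c - v|.
Proof.
move=> /andP[t0 t1].
have -> : c - (t *: u + (1 - t) *: v) = t *: (c - u) + (1 - t) *: (c - v).
  by rewrite !scalerBr addrACA -scalerDl subrKC scale1r opprD.
by rewrite (le_trans (ler_normD _ _))// !normrZ !ger0_norm ?subr_ge0.
Qed.

Lemma convex_ball (c : E) r : convex_subset [set y : E | `|c - y| <= r].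
Proof.
move=> u v t /= hu hv t01; apply: (le_trans (dist_convex c u v t01)).
have /andP[t0 t1] := t01.
have : t * `|c - u| <= t * r by rewrite ler_wpM2l.
have : (1 - t) * `|c - v| <= (1 - t) * r by rewrite ler_wpM2l ?subr_ge0.
lra.
Qed.

Lemma closed_convex_hull_ball A (c : E) r : (forall u, A u -> `|c - u| <= r) ->
  forall u, closed_convex_hull A u -> `|c - u| <= r.
Proof.
move=> Ar; apply: (closed_convex_hull_sub _ (@convex_ball c r)) => //.
exact/closed_sublevel/continuous_dist.
Qed.

(** Balls are closed and convex, so the bound passes to the hull in one argument at a time. *)
Lemma closed_convex_hull_diam A d : (forall u v, A u -> A v -> `|u - v| <= d) ->
  forall u v, closed_convex_hull A u -> closed_convex_hull A v -> `|u - v| <= d.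
Proof.
move=> Ad u v Au; apply: closed_convex_hull_ball => w Aw; rewrite distrC.
by apply: closed_convex_hull_ball Au => w' Aw'; exact: Ad.
Qed.

Definition tail_hull s n := closed_convex_hull [set s m | m in [set m | (n <= m)%N]].

Lemma closed_tail_hull s n : closed (tail_hull s n).
Proof. exact: closed_closed_convex_hull. Qed.

Lemma convex_tail_hull s n : convex_subset (tail_hull s n).
Proof. exact: convex_closed_convex_hull. Qed.

Lemma tail_hull_mem s n m : (n <= m)%N -> tail_hull s n (s m).
Proof. by move=> nm; apply: sub_gen_smallest; exists m. Qed.

Lemma tail_hull_sub s n C : closed C -> convex_subset C ->
  (forall m, (n <= m)%N -> C (s m)) -> tail_hull s n `<=` C.
Proof.
move=> cC vC nC; apply: closed_convex_hull_sub => // _ [m /= nm <-]; exact: nC.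
Qed.

Lemma tail_hull_decr s n m : (n <= m)%N -> tail_hull s m `<=` tail_hull s n.
Proof.
move=> nm; apply: tail_hull_sub => [||k mk].
- exact: closed_tail_hull.
- exact: convex_tail_hull.
- by apply: tail_hull_mem; exact: leq_trans mk.
Qed.

(** A point of all tail hulls plays the part of a weak cluster point: it inherits every closed
    convex property that eventually holds along the sequence. *)
Lemma tail_hull_near s C : closed C -> convex_subset C ->
  (\forall m \near \oo, C (s m)) -> forall z, (forall n, tail_hull s n z) -> C z.
Proof. by move=> cC vC [n _ nC] z zn; exact: (tail_hull_sub cC vC nC (zn n)). Qed.

End ClosedConvexHull.

(** * Almost Chebyshev centres, intersections and fixed minimizers *)

Section UniformNormalStructure.
Set Implicit Arguments.
Unset Strict Implicit.
Unset Printing Implicit Defensive.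
Variables (R : realType) (E : completeNormedModType R).
Implicit Types (C : set E) (s : nat -> E).

Lemma cheb_rad_ge0 C : 0 <= cheb_rad C.
Proof.
have [[c Cc]|C0] := pselect (C !=set0); last first.
  rewrite /cheb_rad (_ : [set r | _] = set0) ?inf0// -subset0 => r [x [Cx _]].
  by apply: C0; exists x.
apply: lb_le_inf; first by exists (rad_at c C), c.
move=> _ [x [Cx ->]].
have [hs|ns] := pselect (has_sup [set r | exists y, C y /\ r = `|x - y|]).
  by apply: (@le_trans _ _ `|x - x|) => //; apply: ub_le_sup; [exact: hs.2|exists x].
by rewrite /rad_at sup_out.
Qed.

Lemma chebyshev_point (kappa : R) C d :
  uniform_normal_structure E -> (normal_structure_coef E)^-1 < kappa ->
  closed C -> convex_subset C -> C !=set0 ->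
  (forall u v, C u -> C v -> `|u - v| <= d) ->
  exists2 x, C x & forall y, C y -> `|x - y| <= kappa * d.
Proof.
rewrite /uniform_normal_structure => N1 Nk cC vC [c Cc] dC.
have N0 : 0 < normal_structure_coef E := lt_trans ltr01 N1.
have k0 : 0 < kappa by apply: lt_trans Nk; rewrite invr_gt0.
have diam_ub : has_ubound [set r | exists x y, C x /\ C y /\ r = `|x - y|].
  by exists d => _ [u [v [Cu [Cv ->]]]]; exact: dC.
have le_diam u v : C u -> C v -> `|u - v| <= diam C.
  by move=> Cu Cv; apply: ub_le_sup => //; exists u, v.
have diam_le : diam C <= d.
  apply: ge_sup; first by exists `|c - c|, c, c.
  by move=> _ [u [v [Cu [Cv ->]]]]; exact: dC.
have kd : kappa * diam C <= kappa * d by rewrite ler_pM2l.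
have [dp|d0] := ltP 0 (diam C); last first.
  exists c => // y Cy; apply: (le_trans (le_diam _ _ Cc Cy)).
  apply: (le_trans d0); rewrite mulr_ge0 ?(ltW k0)//.
  by have := dC _ _ Cc Cc; rewrite subrr normr0.
have cheb_ne : [set r | exists x, C x /\ r = rad_at x C] !=set0.
  by exists (rad_at c C), c.
have Nle : normal_structure_coef E <= diam C / cheb_rad C.
  apply: ge_inf; last first.
    exists C; split=> //; exists (`|c| + d); split=> [|M /ltW ltM y Cy /=].
      exact: num_real.
    apply: le_trans ltM.
    rewrite -(subrKC c y); apply: (le_trans (ler_normD _ _)).
    by rewrite lerD2l dC.
  by exists 0 => _ [D [_ _ _ D0 ->]]; rewrite divr_ge0 ?cheb_rad_ge0 ?ltW.
have cheb_gt0 : 0 < cheb_rad C.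
  (* Division by a zero radius would give the quotient 0, below the positive coefficient. *)
  rewrite lt_neqAle cheb_rad_ge0 andbT; apply/eqP => c0.
  by move: Nle; rewrite -c0 invr0 mulr0 leNgt N0.
have : cheb_rad C < kappa * diam C.
  rewrite ler_pdivlMr// mulrC -ler_pdivlMr// in Nle.
  by apply: (le_lt_trans Nle); rewrite mulrC ltr_pM2r.
move=> /(inf_lt cheb_ne)[_ [x [Cx ->]] xlt]; exists x => // y Cy.
apply: le_trans kd; apply: le_trans (ltW xlt); apply: ub_le_sup; last by exists y.
by exists d => _ [w [Cw ->]]; exact: dC.
Qed.

Variable kappa : R.
Hypothesis kappa01 : 0 <= kappa < 1.
Hypothesis center : forall C d, closed C -> convex_subset C -> C !=set0 ->
  (forall u v, C u -> C v -> `|u - v| <= d) ->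
  exists2 x, C x & forall y, C y -> `|x - y| <= kappa * d.

(** A state of quality [r] is improved to quality [theta * r] while its point moves by at most [r],
    so the points form a Cauchy sequence. States are sequences in one application and points in the
    other. *)
Lemma geometric_dependent_choice (S : Type) (pt : S -> E) (P : R -> S -> Prop)
    (theta r0 : R) (s0 : S) : 0 <= theta < 1 -> 0 <= r0 -> P r0 s0 ->
  (forall (r : R) (s : S), 0 <= r -> P r s ->
    exists2 s', P (theta * r) s' & `|pt s' - pt s| <= r) ->
  exists (s : nat -> S) (z : E),
    (forall k, P (theta ^+ k * r0) (s k)) /\ pt (s k) @[k --> \oo] --> z.
Proof.
move=> /andP[t0 t1] r00 Ps0 step.
have rk k : 0 <= theta ^+ k * r0 by rewrite mulr_ge0 ?exprn_ge0.
have /choice[next Hnext] (ks : nat * S) : exists s' : S,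
    P (theta ^+ ks.1 * r0) ks.2 ->
    P (theta ^+ ks.1.+1 * r0) s' /\ `|pt s' - pt ks.2| <= theta ^+ ks.1 * r0.
  have [Pk|nP] := pselect (P (theta ^+ ks.1 * r0) ks.2); last by exists s0.
  by have [s' Ps' ds'] := step _ _ (rk _) Pk; exists s'; rewrite exprS -mulrA.
pose fix s k := if k is k'.+1 then next (k', s k') else s0.
have Ps k : P (theta ^+ k * r0) (s k).
  by elim: k => [|k IH]; [rewrite expr0 mul1r|exact: (Hnext (k, s k) IH).1].
have ds k : `|pt (s k.+1) - pt (s k)| <= theta ^+ k * r0 by case: (Hnext (k, s k) (Ps k)).
have cv : cvgn (pt \o s).
  have : cvgn (series (telescope (pt \o s))).
    apply: normed_cvg; apply: (@series_le_cvg _ _ (geometric r0 theta)).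
    - by move=> k; exact: normr_ge0.
    - by move=> k; rewrite /= mulrC.
    - by move=> k; apply: (le_trans (ds k)); rewrite /= mulrC.
    - by apply: is_cvg_geometric_series; rewrite ger0_norm.
  rewrite telescopeK => cv.
  have -> : pt \o s = (fun k => (pt \o s) k - (pt \o s) 0%N) \+ cst (pt s0).
    by apply/funext => k /=; rewrite subrK.
  by apply: is_cvgD => //; exact: is_cvg_cst.
by exists s, (limn (pt \o s)).
Qed.

Lemma geometric_le_eps (theta r0 eps : R) : 0 <= theta < 1 -> 0 < eps ->
  \forall k \near \oo, theta ^+ k * r0 <= eps.
Proof.
move=> /andP[t0 t1] e0.
have tn1 : `|theta| < 1 by rewrite ger0_norm.
have /cvgrPdist_le/(_ _ e0) := cvg_geometric r0 tn1; apply: filterS => k.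
by rewrite sub0r normrN /= mulrC => /(le_trans (ler_norm _)).
Qed.

(* Replacing the points of a sequence by almost Chebyshev centres of its tails shrinks its diameter by [kappa] and keeps each point in its own set; this gives the compactness property usually derived from reflexivity. *)
Lemma decreasing_closed_convex_inter (C : nat -> set E) d :
  (forall n, closed (C n)) -> (forall n, convex_subset (C n)) ->
  (forall n, C n !=set0) -> (forall n m, (n <= m)%N -> C m `<=` C n) ->
  (forall u v, C 0%N u -> C 0%N v -> `|u - v| <= d) ->
  exists z, forall n, C n z.
Proof.
move=> cC vC neC decC dC; have [c0 Cc0] := neC 0%N.
have d0 : 0 <= d by have := dC _ _ Cc0 Cc0; rewrite subrr normr0.
pose P r s := (forall n, C n (s n)) /\ forall m n, `|s m - s n| <= r.
have [s0 Cs0] : {s0 : nat -> E & forall n, C n (s0 n)} by apply: choice.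
have Ps0 : P d s0.
  by split=> // m n; apply: dC; apply: (decC 0%N _ (leq0n _)); exact: Cs0.
have [|s [z [Ps sz]]] :=
  geometric_dependent_choice (pt := fun s : nat -> E => s 0%N) kappa01 d0 Ps0.
  move=> r s r0 [Cs ds].
  have hC n : tail_hull s n `<=` C n.
    by apply: tail_hull_sub => // m nm; exact: (decC n m nm _ (Cs m)).
  have hd n : forall u v, tail_hull s n u -> tail_hull s n v -> `|u - v| <= r.
    by apply: closed_convex_hull_diam => _ _ [m _ <-] [m' _ <-].
  have /choice[s' Hs'] n : exists x, tail_hull s n x /\
      forall y, tail_hull s n y -> `|x - y| <= kappa * r.
    have [||||x hx hxy] := @center (tail_hull s n) r; last by exists x.
    - exact: closed_tail_hull.
    - exact: convex_tail_hull.
    - by exists (s n); exact: tail_hull_mem.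
    - exact: hd.
  exists s'; last first.
    by apply: (hd 0%N); [exact: (Hs' 0%N).1|exact: tail_hull_mem].
  split=> [n|m n]; first by apply: hC; exact: (Hs' n).1.
  (* For [m <= n], [s' n] lies in the tail hull from [m], of which [s' m] is an almost Chebyshev
     centre. *)
  wlog mn : m n / (m <= n)%N.
    by move=> W; have /orP[/W//|/W] := leq_total m n; rewrite distrC.
  by apply: (Hs' m).2; exact: (tail_hull_decr mn (Hs' n).1).
(* The diameters tend to 0, so the limit of the initial terms is also the limit of the [n]-th
   terms. *)
exists z => n; apply: (@closed_cvg _ _ \oo _ (fun k => s k n) (C n)) => //.
  by apply: nearW => k; exact: (Ps k).1.
apply/cvgrPdist_le => e e0; have e20 : 0 < e / 2 by lra.
have /cvgrPdist_le/(_ _ e20) h1 := sz.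
have h2 := geometric_le_eps d kappa01 e20.
near=> k; rewrite -(subrKA (s k 0%N)); apply: (le_trans (ler_normD _ _)).
have : `|z - s k 0%N| <= e / 2 by near: k.
have : kappa ^+ k * d <= e / 2 by near: k.
have := (Ps k).2 0%N n; lra.
Unshelve. all: by end_near. Qed.

(** Each almost centre [y n] of a tail hull is within [kappa * delta] of the later terms. The points
    eventually that close to [s], up to any [eps], form a closed convex set, so it contains any
    common point of the tail hulls of [y]. *)
Lemma asymptotic_center s (delta : R) :
  (exists n0, forall i j, (n0 <= i)%N -> (n0 <= j)%N -> `|s i - s j| <= delta) ->
  exists2 z, (forall n, tail_hull s n z) &
    forall eps, 0 < eps -> \forall j \near \oo, `|z - s j| <= kappa * delta + eps.
Proof.
move=> [n0 Hn0].
have hd n : forall u v, tail_hull s (n0 + n) u -> tail_hull s (n0 + n) v -> `|u - v| <= delta.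
  apply: closed_convex_hull_diam => _ _ [i /= ni <-] [j /= nj <-].
  by apply: Hn0; apply: leq_trans (leq_addr n n0) _.
have /choice[y Hy] n : exists x, tail_hull s (n0 + n) x /\
    forall y, tail_hull s (n0 + n) y -> `|x - y| <= kappa * delta.
  have [||||x hx hxy] := @center (tail_hull s (n0 + n)) delta; last by exists x.
  - exact: closed_tail_hull.
  - exact: convex_tail_hull.
  - by exists (s (n0 + n)%N); exact: tail_hull_mem.
  - exact: hd.
have ysub n : tail_hull y n `<=` tail_hull s (n0 + n).
  apply: tail_hull_sub => [||k nk].
  - exact: closed_tail_hull.
  - exact: convex_tail_hull.
  - by apply: (@tail_hull_decr _ _ s (n0 + n) (n0 + k)); rewrite ?leq_add2l//; exact: (Hy k).1.
have [||||| z zy] := @decreasing_closed_convex_inter (tail_hull y) delta.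
- by move=> n; exact: closed_tail_hull.
- by move=> n; exact: convex_tail_hull.
- by move=> n; exists (y n); exact: tail_hull_mem.
- by move=> n m nm; exact: tail_hull_decr.
- by move=> u v hu hv; apply: (hd 0%N); exact: ysub.
exists z.
  by move=> n; apply: (tail_hull_decr (leq_addl n0 n)); exact: ysub.
pose C := [set u : E | forall eps, 0 < eps -> \forall j \near \oo, `|u - s j| <= kappa * delta + eps].
suff : C z by [].
apply: (@tail_hull_sub _ _ y 0%N) (zy 0%N) => [u clu e e0|u v t Cu Cv t01 e e0|n _ e e0].
- have e20 : 0 < e / 2 by lra.
  have [w [Cw uw]] := clu _ (nbhsx_ballx u _ e20).
  near=> j; rewrite -(subrKA w); apply: (le_trans (ler_normD _ _)).
  have : `|u - w| < e / 2 by move: uw; rewrite -ball_normE.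
  have : `|w - s j| <= kappa * delta + e / 2 by near: j; exact: Cw.
  lra.
- near=> j; rewrite distrC; apply: (le_trans (dist_convex _ _ _ t01)).
  have /andP[t0 t1] := t01.
  have hu : `|u - s j| <= kappa * delta + e by near: j; exact: Cu.
  have hv : `|v - s j| <= kappa * delta + e by near: j; exact: Cv.
  rewrite distrC [`|s j - v|]distrC.
  have : t * `|u - s j| <= t * (kappa * delta + e) by rewrite ler_wpM2l.
  have : (1 - t) * `|v - s j| <= (1 - t) * (kappa * delta + e).
    by rewrite ler_wpM2l ?subr_ge0.
  lra.
- near=> j; apply: (@le_trans _ _ (kappa * delta)); last by rewrite lerDl ltW.
  apply: (Hy n).2; apply: tail_hull_mem.
  by near: j; exact: nbhs_infty_ge.
Unshelve. all: by end_near. Qed.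

Lemma fixed_point_minimizer (K : set E) (T : E -> E) (k : nat -> R) (L d : R)
    (phi : E -> R) :
  closed K -> convex_subset K -> K !=set0 ->
  (forall u v, K u -> K v -> `|u - v| <= d) ->
  (forall y, K y -> K (T y)) -> asymp_nonexpansive K T k ->
  k n @[n --> \oo] --> (1 : R) -> (forall n, (1 <= n)%N -> k n <= L) ->
  1 <= L -> L * kappa < 1 ->
  (forall r, closed (K `&` [set y | phi y <= r])) ->
  (forall r, convex_subset (K `&` [set y | phi y <= r])) ->
  (forall y, K y -> 0 <= phi y) ->
  (forall y, K y -> forall eps, 0 < eps ->
     \forall m \near \oo, phi (iter m T y) <= phi y + eps) ->
  exists p, [/\ K p, T p = p & forall y, K y -> phi p <= phi y].
Proof.
move=> cK vK [y1 Ky1] dK TK nonexp k1 kL L1 Lk cphi vphi phi0 phiT.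
have /andP[kap0 kap1] := kappa01.
have d0 : 0 <= d by have := dK _ _ Ky1 Ky1; rewrite subrr normr0.
have TmK m y : K y -> K (iter m T y) by move=> Ky; elim: m => //= m; exact: TK.
pose c := inf (phi @` K).
have hasinf : has_inf (phi @` K).
  by split; [exists (phi y1), y1|exists 0 => _ [y Ky <-]; exact: phi0].
have c_le y : K y -> c <= phi y by move=> Ky; apply: ge_inf; [exact: hasinf.2|exists y].
have [|||||y0 Hy0] := @decreasing_closed_convex_inter
  (fun n => K `&` [set y | phi y <= c + n.+1%:R^-1]) d.
- by move=> n; exact: cphi.
- by move=> n; exact: vphi.
- move=> n; have n0 : 0 < n.+1%:R^-1 :> R by rewrite invr_gt0.
  by have [_ [y Ky <-] /ltW le] := inf_adherent n0 hasinf; exists y.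
- move=> n m nm y [Ky /= le]; split=> //=; apply: (le_trans le).
  by rewrite lerD2l lef_pV2 ?posrE// ler_nat.
- by move=> u v [Ku _] [Kv _]; exact: dK.
have Ky0 : K y0 := (Hy0 0%N).1.
have phiy0 : phi y0 <= c.
  rewrite leNgt; apply/negP => /ltr_add_invr[n].
  by rewrite ltNge (Hy0 n).2.
(* As [q < 1], these satisfy [1 < lam] and [theta < 1]: [lam] absorbs [k j] for large [j], and
   [theta] is the contraction rate of the scheme. *)
pose q := L * kappa; pose lam := 2 / (1 + q); pose theta := q * lam.
have q0 : 0 <= q by rewrite mulr_ge0// (le_trans ler01).
have lam1 : 1 < lam by rewrite ltr_pdivlMr ?mul1r; rewrite /q in q0 *; lra.
have theta01 : 0 <= theta < 1.
  rewrite mulr_ge0//=; last by rewrite (le_trans ler01)// ltW.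
  by rewrite /theta /lam mulrA ltr_pdivrMr ?mul1r; rewrite /q in q0 *; lra.
(* The quality of a minimizer is the radius of its orbit about it. The orbit tail has diameter at
   most [lam * r], because T^i y - T^j y is T^j applied to T^(i-j) y and y. *)
pose P r y := [/\ K y, phi y <= c & forall m, (1 <= m)%N -> `|iter m T y - y| <= r].
have P0 : P d y0 by split=> // m _; apply: dK => //; exact: TmK.
have [|s [p [Ps sp]]] := geometric_dependent_choice (pt := id) theta01 d0 P0.
  move=> r y r0 [Ky phiy yr]; pose s m := iter m T y.
  have [|z zs zc] := @asymptotic_center s (lam * r).
    have [n0 _ Hn0] : \forall n \near \oo, k n <= lam by exact: cvgr_le k1 _ lam1.
    exists n0.+1 => i j; wlog ji : i j / (j <= i)%N.
      move=> W ni nj; have /orP[ij|ji] := leq_total i j; last exact: W.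
      by rewrite distrC W.
    move=> ni nj; have [<-|ne] := eqVneq j i.
      by rewrite subrr normr0 mulr_ge0// (le_trans ler01)// ltW.
    have -> : s i = iter j T (iter (i - j) T y) by rewrite -iterD subnKC.
    have j1 : (1 <= j)%N := leq_ltn_trans (leq0n n0) nj.
    apply: (le_trans (nonexp j j1 _ _ (TmK _ _ Ky) Ky)).
    apply: (@le_trans _ _ (lam * `|iter (i - j) T y - y|)).
      by rewrite ler_wpM2r// Hn0//= ltnW.
    rewrite ler_wpM2l ?(le_trans ler01) ?(ltW lam1)// yr//.
    by rewrite subn_gt0 ltn_neqAle ne.
  have [Kz phiz] : K z /\ phi z <= c.
    have inC e : 0 < e -> (K `&` [set u | phi u <= c + e]) z.
      move=> e0; apply: (tail_hull_near (cphi _) (vphi _) _ zs).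
      near=> m; split; first exact: TmK.
      apply: (@le_trans _ _ (phi y + e)); last by rewrite lerD2r.
      by near: m; exact: phiT.
    split; first exact: (inC 1 ltr01).1.
    by apply/ler_addgt0Pr => e e0; exact: (inC e e0).2.
  exists z; last first.
    rewrite distrC; apply: (tail_hull_sub _ (@convex_ball _ _ y r) _ (zs 1%N)).
      exact/closed_sublevel/continuous_dist.
    by move=> m m1 /=; rewrite distrC; exact: yr.
  (* T^m z is within L (kappa lam r) + e of T^i y for large i; as [z] lies in the tail hulls of the
     orbit, the same bound holds for T^m z and z. *)
  split=> // m m1; apply/ler_addgt0Pr => e e0.
  apply: (@tail_hull_near _ _ s [set u | `|iter m T z - u| <= theta * r + e] _ _ _ _ zs).
  - exact/closed_sublevel/continuous_dist.
  - exact: convex_ball.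
  have L0 : 0 < L := lt_le_trans ltr01 L1.
  have eL : 0 < e / L by rewrite divr_gt0.
  have [N _ HN] := zc _ eL; exists (N + m)%N => // i /= Ni.
  have mi : (m <= i)%N := leq_trans (leq_addl N m) Ni.
  have -> : s i = iter m T (s (i - m)%N) by rewrite /s -iterD subnKC.
  apply: (le_trans (nonexp m m1 _ _ Kz (TmK _ _ Ky))).
  apply: (le_trans (ler_wpM2r (normr_ge0 _) (kL m m1))).
  apply: (@le_trans _ _ (L * (kappa * (lam * r) + e / L))).
    by rewrite ler_wpM2l ?(ltW L0)//; apply: HN; rewrite /= leq_subRL// addnC.
  by rewrite mulrDr [L * (e / L)]mulrC divfK ?gt_eqF// /theta /q !mulrA.
have [Kp /= phip] : (K `&` [set y | phi y <= c]) p.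
  apply: (@closed_cvg _ _ \oo _ s) sp => //.
  by apply: nearW => n; have [] := Ps n.
exists p; split=> //; last by move=> y Ky; apply: (le_trans phip); exact: c_le.
apply/eqP; rewrite -subr_eq0 -normr_le0; apply/ler_addgt0Pr => e e0.
have L20 : 0 < L + 1 by lra.
have e10 : 0 < e / 2 by lra.
have e20 : 0 < e / 2 / (L + 1) by rewrite divr_gt0.
have /cvgrPdist_le/(_ _ e20) h1 := sp.
have h2 := geometric_le_eps d theta01 e10.
near \oo => n; rewrite add0r.
have [Ksn _ /(_ 1%N isT) /= Tsn] := Ps n.
have : `|p - s n| <= e / 2 / (L + 1) by near: n.
rewrite ler_pdivlMr// => pn.
have sn : theta ^+ n * d <= e / 2 by near: n.
have Tn := nonexp 1%N isT _ _ Kp Ksn; rewrite /= in Tn.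
have kn : k 1%N * `|p - s n| <= L * `|p - s n| by rewrite ler_wpM2r// kL.
have := ler_distD (T (s n)) (T p) p; have := ler_distD (s n) (T (s n)) p.
rewrite [`|s n - p|]distrC; lra.
Unshelve. all: by end_near. Qed.

End UniformNormalStructure.

(** * Weighted means *)

Section WeightedMeans.
Set Implicit Arguments.
Unset Strict Implicit.
Unset Printing Implicit Defensive.
Variable R : realType.
Implicit Types (u v h : nat -> R).

(** This says limsup u <= 0; it is one-sided because duality terms are controlled from above only.
    For nonnegative sequences it is convergence to 0. *)
Definition upper_null u := forall eps, 0 < eps -> \forall i \near \oo, u i <= eps.

Lemma cvg0_upper_null u : u i @[i --> \oo] --> (0 : R) -> upper_null u.
Proof.
move=> /cvgrPdist_le u0 eps e0; have := u0 _ e0; apply: filterS => i.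
by rewrite sub0r normrN => /(le_trans (ler_norm _)).
Qed.

Lemma upper_null_le u v : (\forall i \near \oo, u i <= v i) ->
  upper_null v -> upper_null u.
Proof.
move=> uv v0 eps e0; have h := v0 _ e0; near=> i.
by apply: (@le_trans _ _ (v i)); near: i.
Unshelve. all: by end_near. Qed.

Lemma upper_nullS u : upper_null (fun i => u i.+1) <-> upper_null u.
Proof.
split=> u0 eps e0; have [N _ HN] := u0 _ e0.
  by exists N.+1 => // -[|i]//= ?; exact: HN.
by exists N => // i /= ?; apply: HN; exact: leq_trans (leqnSn i).
Qed.

Lemma upper_nullD u v : upper_null u -> upper_null v ->
  upper_null (fun i => u i + v i).
Proof.
move=> u0 v0 eps e0; have e20 : 0 < eps / 2 by lra.
have hu := u0 _ e20; have hv := v0 _ e20; near=> i.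
have : u i <= eps / 2 by near: i.
have : v i <= eps / 2 by near: i.
lra.
Unshelve. all: by end_near. Qed.

Lemma upper_nullZ (c : R) u : 0 <= c -> upper_null u -> upper_null (fun i => c * u i).
Proof.
move=> c0 u0 eps e0; have d0 : 0 < eps / (c + 1) by rewrite divr_gt0// ltr_pwDr.
have := u0 _ d0; apply: filterS => i le.
apply: (@le_trans _ _ (c * (eps / (c + 1)))); first by rewrite ler_wpM2l.
rewrite mulrA ler_pdivrMr ?ltr_pwDr//.
by have : 0 <= eps by [exact: ltW]; lra.
Qed.

Lemma upper_null_sum (u : nat -> nat -> R) N : (forall m, upper_null (u m)) ->
  upper_null (fun n => \sum_(i < N) u i n).
Proof.
move=> u0; elim: N => [|N IH].
  by move=> eps e0; apply: nearW => n; rewrite big_ord0 ltW.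
have := upper_nullD IH (u0 N); apply: upper_null_le.
by apply: nearW => n; rewrite big_ord_recr.
Qed.

Variable w : nat -> R.
Hypothesis w0 : forall i, 0 < w i.
Hypothesis w_div : (\sum_(i < N) w i) @[N --> \oo] --> +oo.

Definition wsum u N := \sum_(i < N) w i * u i.

Lemma wsum_le u v N : (forall i, u i <= v i) -> wsum u N <= wsum v N.
Proof. by move=> uv; apply: ler_sum => i _; rewrite ler_pM2l. Qed.

Lemma wsumD u v N : wsum (fun i => u i + v i) N = wsum u N + wsum v N.
Proof. by rewrite -big_split /=; apply: eq_bigr => i _; rewrite mulrDr. Qed.

Lemma wsumZ (c : R) u N : wsum (fun i => c * u i) N = c * wsum u N.
Proof. by rewrite mulr_sumr; apply: eq_bigr => i _; rewrite mulrCA. Qed.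

Lemma wsum_cst (c : R) N : wsum (fun=> c) N = c * \sum_(i < N) w i.
Proof. by rewrite mulr_sumr; apply: eq_bigr => i _; rewrite mulrC. Qed.

Lemma weight_ge0 N : 0 <= \sum_(i < N) w i.
Proof. by apply: sumr_ge0 => i _; exact: ltW. Qed.

Lemma weight_large (B eps : R) : 0 < eps ->
  \forall N \near \oo, B <= eps * \sum_(i < N) w i.
Proof.
move=> e0; have /cvgryPge/(_ (B / eps)) := w_div.
by apply: filterS => N; rewrite ler_pdivrMr// mulrC.
Qed.

Lemma weight_gt0 : \forall N \near \oo, 0 < \sum_(i < N) w i.
Proof.
by have := weight_large 1 ltr01; apply: filterS => N; rewrite mul1r; exact: lt_le_trans.
Qed.

(** Cesaro argument: divergence of the total weight absorbs the initial segment. *)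
Lemma wsum_upper_null u eps : upper_null u -> 0 < eps ->
  \forall N \near \oo, wsum u N <= eps * \sum_(i < N) w i.
Proof.
move=> u0 e0; have e20 : 0 < eps / 2 by lra.
have [n0 _ Hn0] := u0 _ e20.
pose B := \sum_(i < n0) w i * `|u i|.
have key j : wsum u (n0 + j)%N <= B + eps / 2 * \sum_(i < n0 + j) w i.
  elim: j => [|j IH].
    rewrite addn0; apply: (@le_trans _ _ B).
      by apply: ler_sum => i _; rewrite ler_pM2l// ler_norm.
    by rewrite lerDl mulr_ge0 ?weight_ge0// ltW.
  rewrite addnS /wsum !big_ord_recr /= -/(wsum u _) mulrDr addrA lerD//.
  by rewrite mulrC ler_pM2r//; apply: Hn0; rewrite /= leq_addr.
have hB := weight_large B e20; near=> N.
have n0N : (n0 <= N)%N by near: N; exact: nbhs_infty_ge.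
have := key (N - n0)%N; rewrite subnKC// => /le_trans; apply.
have : B <= eps / 2 * \sum_(i < N) w i by near: N.
lra.
Unshelve. all: by end_near. Qed.

Lemma recursion_wsum (Y g : nat -> R) N :
  (forall i, Y i.+1 <= Y i + w i * g i) -> Y N <= Y 0%N + wsum g N.
Proof.
move=> H; elim: N => [|N IH]; first by rewrite /wsum big_ord0 addr0.
by apply: (le_trans (H N)); rewrite /wsum big_ord_recr /= addrA lerD2r.
Qed.

(** Once [h] is below [delta * eps / 2], the level [eps] is never left upwards. While [Y] stays
    above it, each step loses at least [w i * delta * eps / 2], impossible for ever since the
    weights diverge. *)
Lemma recursion_upper_null (delta : R) (Y h : nat -> R) :
  0 < delta -> (forall i, w i * delta <= 1) -> (forall i, 0 <= Y i) ->
  upper_null h -> (forall i, Y i.+1 <= (1 - w i * delta) * Y i + w i * h i) ->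
  upper_null Y.
Proof.
move=> d0 wd Y0 h0 rec eps e0.
have de0 : 0 < delta * eps / 2 by rewrite divr_gt0// mulr_gt0.
have [n0 _ Hn0] := h0 _ de0.
have hle i : (n0 <= i)%N -> w i * h i <= w i * (delta * eps / 2).
  by move=> ni; rewrite ler_pM2l// Hn0.
have wde i : 0 <= w i * (delta * eps / 2) by rewrite mulr_ge0 ?ltW.
have prop i : (n0 <= i)%N -> Y i <= eps -> Y i.+1 <= eps.
  move=> ni Yi; apply: (le_trans (rec i)).
  have : (1 - w i * delta) * Y i <= (1 - w i * delta) * eps.
    by rewrite ler_wpM2l ?subr_ge0.
  by have := hle i ni; have := wde i; lra.
have [[m [nm Ym]]|none] := pselect (exists m, (n0 <= m)%N /\ Y m <= eps).
  exists m => // i /= mi; rewrite -(subnKC mi); elim: (i - m)%N => [|j IH].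
    by rewrite addn0.
  by rewrite addnS; apply: prop => //; exact: leq_trans (leq_addr _ _).
exfalso.
have gt i : (n0 <= i)%N -> eps < Y i.
  by move=> ni; rewrite ltNge; apply/negP => le; apply: none; exists i.
have key j : Y (n0 + j)%N + delta * eps / 2 * (\sum_(i < n0 + j) w i)
    <= Y n0 + delta * eps / 2 * (\sum_(i < n0) w i).
  elim: j => [|j IH]; first by rewrite addn0.
  rewrite addnS big_ord_recr /= mulrDr; apply: le_trans IH.
  have nj : (n0 <= n0 + j)%N := leq_addr _ _.
  have := rec (n0 + j)%N; have := hle _ nj.
  have : w (n0 + j)%N * delta * eps <= w (n0 + j)%N * delta * Y (n0 + j)%N.
    by rewrite ler_pM2l ?mulr_gt0// ltW// gt.
  lra.
have [N _ HN] := weight_large (Y n0 + delta * eps / 2 * (\sum_(i < n0) w i) + 1) de0.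
have := key N; have := HN (n0 + N)%N (leq_addl _ _); have := Y0 (n0 + N)%N.
rewrite /=; lra.
Qed.

(** The limsup of the weighted means as an infimum of eventual bounds, which avoids dividing by the
    total weight, zero at [N = 0]. *)
Definition wlimsup u := inf [set r | \forall N \near \oo, wsum u N <= r * \sum_(i < N) w i].

Lemma wlimsup_has_lbound u : (forall i, 0 <= u i) ->
  lbound [set r | \forall N \near \oo, wsum u N <= r * \sum_(i < N) w i] 0.
Proof.
move=> u0 r hr; near \oo => N; rewrite leNgt; apply/negP => r0.
have W0 : 0 < \sum_(i < N) w i by near: N; exact: weight_gt0.
have : wsum u N <= r * \sum_(i < N) w i by near: N.
rewrite leNgt => /negP; apply; apply: (@lt_le_trans _ _ 0).
  by rewrite nmulr_rlt0.
by apply: sumr_ge0 => i _; rewrite mulr_ge0// ltW.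
Unshelve. all: by end_near. Qed.

Lemma wlimsup_le u r : (forall i, 0 <= u i) ->
  (forall eps, 0 < eps -> \forall N \near \oo, wsum u N <= (r + eps) * \sum_(i < N) w i) ->
  wlimsup u <= r.
Proof.
move=> u0 hr; apply/ler_addgt0Pr => e e0.
by apply: ge_inf; [exists 0; exact: wlimsup_has_lbound|exact: hr].
Qed.

Lemma wlimsup_ge0 u (M : R) : (forall i, 0 <= u i <= M) -> 0 <= wlimsup u.
Proof.
move=> uM; apply: lb_le_inf; last by apply: wlimsup_has_lbound => i; case/andP: (uM i).
by exists M; apply: nearW => N; rewrite -wsum_cst wsum_le// => i; case/andP: (uM i).
Qed.

Lemma wsum_le_wlimsup u (M eps : R) : (forall i, 0 <= u i <= M) -> 0 < eps ->
  \forall N \near \oo, wsum u N <= (wlimsup u + eps) * \sum_(i < N) w i.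
Proof.
move=> uM e0; have lt : wlimsup u < wlimsup u + eps by rewrite ltrDl.
have [|r hr ltr] := inf_lt _ lt.
  by exists M; apply: nearW => N; rewrite -wsum_cst wsum_le// => i; case/andP: (uM i).
apply: filterS hr => N /le_trans; apply.
by rewrite ler_wpM2r ?weight_ge0// ltW.
Qed.

End WeightedMeans.

(** * The iteration *)

Section ViscosityIteration.
Set Implicit Arguments.
Unset Strict Implicit.
Unset Printing Implicit Defensive.
Variables (R : realType) (E : completeNormedModType R).
Variables (K : set E) (T f : E -> E) (k a b c : nat -> R) (alpha d L : R).
(* Indices are shifted: [X i], [a i], [b i], [c i] are the paper's terms of index [i + 1], which explains the iterate [T^(i + 1)] below. *)
Variable X : nat -> E.

Hypothesis smooth : unif_gateaux_norm E.
Hypothesis cK : closed K.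
Hypothesis vK : convex_subset K.
Hypothesis dK : forall u v, K u -> K v -> `|u - v| <= d.
Hypothesis TK : forall y, K y -> K (T y).
Hypothesis k_gt0 : forall n, (1 <= n)%N -> 0 < k n.
Hypothesis k_cvg : k n @[n --> \oo] --> (1 : R).
Hypothesis k_le : forall n, (1 <= n)%N -> k n <= L.
Hypothesis nonexp : asymp_nonexpansive K T k.
Hypothesis fK : forall y, K y -> K (f y).
Hypothesis alpha01 : 0 <= alpha < 1.
Hypothesis f_contr : forall y z, K y -> K z -> `|f y - f z| <= alpha * `|y - z|.
Hypothesis a01 : forall i, 0 < a i < 1.
Hypothesis b01 : forall i, 0 <= b i < 1.
Hypothesis c01 : forall i, 0 < c i < 1.
Hypothesis abc : forall i, a i + b i + c i = 1.
Hypothesis a_null : upper_null a.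
Hypothesis a_div : (\sum_(i < N) a i) @[N --> \oo] --> +oo.
Hypothesis k_null : upper_null (fun i => `|k i.+1 ^+ 2 - 1| / a i).
Hypothesis XK : forall i, K (X i).
Hypothesis X_rec : forall i, X i.+1 = a i *: f (X i) + b i *: X i
  + c i *: iter i.+1 T (2^-1 *: (X i + X i.+1)).
Hypothesis X_approx : upper_null (fun i => `|X i - iter i.+1 T (X i)|).

Let eta i := `|k i.+1 ^+ 2 - 1| / a i.
(* The denominator comes from moving the [X i.+1] half of the midpoint to the left-hand side. *)
Let w i := a i / (1 - c i / 2).
Let mid i := 2^-1 *: (X i + X i.+1).

Lemma diam_ge0 : 0 <= d.
Proof. by have := dK (XK 0) (XK 0); rewrite subrr normr0. Qed.

Lemma iterK m y : K y -> K (iter m T y).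
Proof. by move=> Ky; elim: m => //= m; exact: TK. Qed.

Lemma midK i : K (mid i).
Proof.
rewrite /mid scalerDr (_ : (2^-1 *: X i.+1) = (1 - 2^-1) *: X i.+1); last first.
  by congr (_ *: _); field.
by apply: vK => //; lra.
Qed.

Lemma weight_le i : a i <= w i.
Proof.
have /andP[a0 _] := a01 i; have /andP[c0 c1] := c01 i.
by rewrite ler_pdivlMr ?ler_piMr ?(ltW a0)//; lra.
Qed.

Lemma weight_pos i : 0 < w i.
Proof. by apply: lt_le_trans (weight_le i); case/andP: (a01 i). Qed.

Lemma weight_div : (\sum_(i < N) w i) @[N --> \oo] --> +oo.
Proof.
apply/cvgryPge => A; have /cvgryPge/(_ A) := a_div; apply: filterS => N /le_trans.
by apply; apply: ler_sum => i _; exact: weight_le.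
Qed.

Lemma mid_sqr_le q i :
  `|mid i - q| ^+ 2 <= (`|X i - q| ^+ 2 + `|X i.+1 - q| ^+ 2) / 2.
Proof.
have h12 : 0 <= (2^-1 : R) <= 1 by lra.
have := norm_sqr_convex2 (X i - q) (X i.+1 - q) h12.
have -> : 1 - 2^-1 = 2^-1 :> R by field.
have -> : 2^-1 *: (X i - q) + 2^-1 *: (X i.+1 - q) = mid i - q.
  rewrite -scalerDr addrACA -opprD /mid scalerBr -mulr2n -[q *+ 2]scaler_nat.
  by rewrite scalerA mulVf ?pnatr_eq0// scale1r.
lra.
Qed.

(* The splitting [A + h] of [f (X i) - q] decides which part of the viscosity term is estimated by convexity and which by the duality map. *)
Lemma step_le i q A h e : K q -> A + h = f (X i) - q ->
  `|q - iter i.+1 T q| <= e -> e <= d ->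
  (1 - c i / 2) * `|X i.+1 - q| ^+ 2 <=
    a i * `|A| ^+ 2 + (b i + c i / 2) * `|X i - q| ^+ 2
    + a i * (eta i * d ^+ 2 + 2 * dirder (X i.+1 - q) h) + (2 * L + 1) * d * e.
Proof.
move=> Kq Ah qe ed.
have /andP[a0 a1] := a01 i; have /andP[b0 b1] := b01 i; have /andP[c0 c1] := c01 i.
have d0 := diam_ge0; have e0 : 0 <= e := le_trans (normr_ge0 _) qe.
pose B := iter i.+1 T (mid i) - q.
have XE : X i.+1 - q = (a i *: A + b i *: (X i - q) + c i *: B) + a i *: h.
  have qE : q = a i *: q + b i *: q + c i *: q by rewrite -!scalerDl abc scale1r.
  rewrite [RHS]addrC !addrA -scalerDr [h + A]addrC Ah !scalerBr.
  rewrite X_rec -/(mid i) {1}qE opprD addrACA; congr (_ + _).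
  by rewrite opprD addrACA.
(* Expanding (k s + e)^2 leaves s^2, an excess (k^2 - 1) s^2 absorbed by [a i * eta i], and a
   remainder linear in [e] because [e <= d]. *)
have Bs : `|B| ^+ 2 <= (`|X i - q| ^+ 2 + `|X i.+1 - q| ^+ 2) / 2
    + a i * (eta i * d ^+ 2) + (2 * L + 1) * d * e.
  pose s := `|mid i - q|.
  have s0 : 0 <= s by exact: normr_ge0.
  have sd : s <= d by apply: dK => //; exact: midK.
  have k0 := k_gt0 (ltn0Sn i); have kL := k_le (ltn0Sn i).
  have Bk : `|B| <= k i.+1 * s + e.
    have := ler_distD (iter i.+1 T q) (iter i.+1 T (mid i)) q.
    have := nonexp (ltn0Sn i) (midK i) Kq.
    have : `|iter i.+1 T q - q| <= e by rewrite distrC.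
    rewrite -/B -/s; lra.
  have B2 : `|B| ^+ 2 <= (k i.+1 * s + e) ^+ 2.
    by rewrite ler_pXn2r ?nnegrE// addr_ge0// mulr_ge0// ltW.
  have s2d : s ^+ 2 <= d ^+ 2 by rewrite ler_pXn2r ?nnegrE.
  have h1 : (k i.+1 ^+ 2 - 1) * s ^+ 2 <= a i * (eta i * d ^+ 2).
    have aE : a i * eta i = `|k i.+1 ^+ 2 - 1| by rewrite /eta mulrC divfK ?gt_eqF.
    rewrite [leRHS]mulrA aE.
    apply: (@le_trans _ _ (`|k i.+1 ^+ 2 - 1| * s ^+ 2)).
      by rewrite ler_wpM2r ?sqr_ge0// ler_norm.
    by rewrite ler_wpM2l.
  have h2 : e * (2 * (k i.+1 * s) + e) <= e * ((2 * L + 1) * d).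
    rewrite ler_wpM2l//.
    have : k i.+1 * s <= L * d by apply: ler_pM => //; exact: ltW.
    lra.
  have := mid_sqr_le q i; rewrite -/s.
  move: B2 h1 h2; rewrite !expr2; lra.
have := sqnormD_dirder (a i *: A + b i *: (X i - q) + c i *: B) (a i *: h).
rewrite -XE dirderZ//.
have := norm_sqr_convex3 A (X i - q) B (ltW a0) b0 (ltW c0) (abc i).
(* The factor [c i <= 1] is dropped from the errors but kept on the main term, half of which moves
   to the left-hand side. *)
have h3 : c i * `|B| ^+ 2 <= c i * ((`|X i - q| ^+ 2 + `|X i.+1 - q| ^+ 2) / 2)
    + a i * (eta i * d ^+ 2) + (2 * L + 1) * d * e.
  have : c i * `|B| ^+ 2 <= c i * ((`|X i - q| ^+ 2 + `|X i.+1 - q| ^+ 2) / 2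
    + a i * (eta i * d ^+ 2) + (2 * L + 1) * d * e) by rewrite ler_pM2l.
  have L0 : 0 <= L by rewrite (le_trans _ (k_le (ltn0Sn i)))// ltW// k_gt0.
  have p0 : 0 <= a i * (eta i * d ^+ 2).
    by rewrite mulr_ge0 ?(ltW a0)// mulr_ge0 ?sqr_ge0// divr_ge0 ?(ltW a0).
  have p1 : 0 <= (2 * L + 1) * d * e by rewrite !mulr_ge0// addr_ge0// mulr_ge0.
  have : c i * (a i * (eta i * d ^+ 2)) <= a i * (eta i * d ^+ 2) by rewrite ler_piMl// ltW.
  have : c i * ((2 * L + 1) * d * e) <= (2 * L + 1) * d * e by rewrite ler_piMl// ltW.
  rewrite !mulrDr; lra.
lra.
Qed.

(** * Asymptotic regularity of the iterates *)

Lemma L_ge0 : 0 <= L.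
Proof. by rewrite (le_trans _ (k_le (ltnSn 0)))// ltW// k_gt0. Qed.

Lemma iter_lip m u v : (1 <= m)%N -> K u -> K v ->
  `|iter m T u - iter m T v| <= L * `|u - v|.
Proof.
move=> m1 Ku Kv; apply: (le_trans (nonexp m1 Ku Kv)).
by rewrite ler_wpM2r// k_le.
Qed.

(** The midpoint is half a step from [X i], so once [k] is at most 3/2 the implicit term contributes
    at most 3/4 of the step; absorbing it on the left produces the factor 4. *)
Lemma X_step_null : upper_null (fun i => `|X i.+1 - X i|).
Proof.
have : upper_null (fun i => 4 * d * a i + 4 * `|X i - iter i.+1 T (X i)|).
  by apply: upper_nullD; apply: upper_nullZ; rewrite ?mulr_ge0 ?diam_ge0.
apply: upper_null_le.
have k32 : \forall n \near \oo, k n <= 3 / 2 by apply: (cvgr_le _ k_cvg); lra.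
have {k32} [N _ HN] := k32; exists N => // i Ni; rewrite /= in Ni.
have ki : k i.+1 <= 3 / 2 by apply: HN; exact: leq_trans (leqnSn i).
have /andP[a0 a1] := a01 i; have /andP[c0 c1] := c01 i.
have XE : X i.+1 - X i = a i *: (f (X i) - X i) + c i *: (iter i.+1 T (mid i) - X i).
  have qE : X i = a i *: X i + b i *: X i + c i *: X i by rewrite -!scalerDl abc scale1r.
  rewrite {1}X_rec -/(mid i) {3}qE opprD addrACA !scalerBr; congr (_ + _).
  by rewrite opprD addrACA subrr addr0.
have midX : `|mid i - X i| = `|X i.+1 - X i| / 2.
  have -> : mid i - X i = 2^-1 *: (X i.+1 - X i).
    rewrite /mid scalerDr scalerBr [RHS]addrC addrAC; congr (_ + _).
    rewrite -{2}(scale1r (X i)) -scalerBl -scaleNr; congr (_ *: _).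
    by field.
  by rewrite normrZ ger0_norm ?invr_ge0// mulrC.
have h1 : `|X i.+1 - X i| <= a i * `|f (X i) - X i| + c i * `|iter i.+1 T (mid i) - X i|.
  by rewrite {1}XE (le_trans (ler_normD _ _))// !normrZ !gtr0_norm.
have h2 : a i * `|f (X i) - X i| <= a i * d.
  by rewrite ler_pM2l// dK//; exact: fK.
have h3 : c i * `|iter i.+1 T (mid i) - X i| <= `|iter i.+1 T (mid i) - X i|.
  by rewrite ler_piMl// ltW.
have h4 := ler_distD (iter i.+1 T (X i)) (iter i.+1 T (mid i)) (X i).
have h5 := nonexp (ltn0Sn i) (midK i) (XK i).
have h6 : k i.+1 * `|mid i - X i| <= 3 / 2 * `|mid i - X i| by rewrite ler_wpM2r.
rewrite midX in h5 h6; rewrite [`|X i - iter i.+1 T (X i)|]distrC.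
lra.
Qed.

Lemma X_approx_iter m : upper_null (fun i => `|X i - iter m T (X i)|).
Proof.
have T1 : upper_null (fun i => `|X i - T (X i)|).
  apply/upper_nullS; have L0 := L_ge0.
  (* The order of the iterate in [X_approx] moves with [i]; passing through T^(i+2) at [X i.+1]
     isolates a single application of [T]. *)
  have : upper_null (fun i => `|X i.+1 - iter i.+2 T (X i.+1)| +
      L * ((L + 1) * `|X i.+1 - X i| + `|X i - iter i.+1 T (X i)|)).
    apply: upper_nullD; first exact: ((upper_nullS _).2 X_approx).
    apply: upper_nullZ => //; apply: upper_nullD => //.
    by apply: upper_nullZ; [lra|exact: X_step_null].
  apply: upper_null_le; apply: nearW => i.
  apply: (le_trans (ler_distD (iter i.+2 T (X i.+1)) _ _)); rewrite lerD2l.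
  apply: (le_trans (iter_lip (ltnSn 0) (iterK i.+1 (XK _)) (XK _))).
  rewrite ler_wpM2l//.
  have := ler_distD (iter i.+1 T (X i)) (iter i.+1 T (X i.+1)) (X i.+1).
  have := ler_distD (X i) (iter i.+1 T (X i)) (X i.+1).
  have := iter_lip (ltn0Sn i) (XK i.+1) (XK i).
  rewrite [`|X i - X i.+1|]distrC [`|X i - iter _ _ _|]distrC; lra.
elim: m => [|m IH].
  by move=> eps e0; apply: nearW => i; rewrite subrr normr0 ltW.
have := upper_nullD T1 (upper_nullZ L_ge0 IH).
apply: upper_null_le; apply: nearW => i.
apply: (le_trans (ler_distD (T (X i)) _ _)); rewrite lerD2l.
exact: (iter_lip (ltnSn 0) (XK _) (iterK m (XK _))).
Qed.

(* The weighted means replace a Banach limit; only their limsup is needed. *)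
Definition phi y := wlimsup w (fun i => `|X i - y| ^+ 2).

(** * Closedness, convexity and behaviour under [T] of the sublevel sets of [phi] *)

Lemma sqdist_bound y i : K y -> 0 <= `|X i - y| ^+ 2 <= d ^+ 2.
Proof. by move=> Ky; rewrite sqr_ge0/= ler_pXn2r ?nnegrE ?diam_ge0// dK. Qed.

Lemma phi_le r y : (forall eps, 0 < eps -> \forall N \near \oo,
    wsum w (fun i => `|X i - y| ^+ 2) N <= (r + eps) * \sum_(i < N) w i) ->
  phi y <= r.
Proof.
by apply: wlimsup_le; [exact: weight_pos|exact: weight_div|move=> i; exact: sqr_ge0].
Qed.

Lemma phi_near y eps : K y -> 0 < eps -> \forall N \near \oo,
  wsum w (fun i => `|X i - y| ^+ 2) N <= (phi y + eps) * \sum_(i < N) w i.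
Proof.
move=> Ky; apply: (wsum_le_wlimsup weight_pos (M := d ^+ 2)) => i.
exact: sqdist_bound.
Qed.

Lemma phi_ge0 y : K y -> 0 <= phi y.
Proof.
move=> Ky; apply: (wlimsup_ge0 weight_pos weight_div (M := d ^+ 2)) => i.
exact: sqdist_bound.
Qed.

Lemma phi_lip u v : K u -> K v -> phi u <= phi v + 2 * d * `|u - v|.
Proof.
move=> Ku Kv; apply: phi_le => eps e0; have h := phi_near Kv e0.
near=> N; have hN : wsum w (fun i => `|X i - v| ^+ 2) N <= (phi v + eps) * \sum_(i < N) w i by near: N.
apply: (@le_trans _ _ (wsum w (fun i => `|X i - v| ^+ 2 + 2 * d * `|u - v|) N)).
  apply: wsum_le => [i|i]; first exact: weight_pos.
  have := ler_distD v (X i) u; rewrite [`|v - u|]distrC => h1.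
  have := dK (XK i) Ku; have := dK (XK i) Kv => h2 h3.
  have : (`|X i - u| - `|X i - v|) * (`|X i - u| + `|X i - v|) <= `|u - v| * (2 * d).
    apply: (@le_trans _ _ (`|u - v| * (`|X i - u| + `|X i - v|))).
      by rewrite ler_wpM2r ?addr_ge0//; lra.
    by rewrite ler_wpM2l//; lra.
  rewrite -subr_sqr; lra.
by rewrite wsumD wsum_cst; lra.
Unshelve. all: by end_near. Qed.

Lemma phi_sublevel_closed r : closed (K `&` [set y | phi y <= r]).
Proof.
move=> u clu; have Ku : K u by apply: cK => B /clu[v [[Kv _] Bv]]; exists v.
split=> //=; apply/ler_addgt0Pr => e e0.
have d0 := diam_ge0; have D0 : 0 < 2 * d + 1 by lra.
have eD : 0 < e / (2 * d + 1) by rewrite divr_gt0.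
have [v [[Kv /= phiv] uv]] := clu _ (nbhsx_ballx u _ eD).
apply: (le_trans (phi_lip Ku Kv)); rewrite lerD//.
move: uv; rewrite -ball_normE /= => /ltW; rewrite ler_pdivlMr//.
have := normr_ge0 (u - v); lra.
Qed.

Lemma phi_sublevel_convex r : convex_subset (K `&` [set y | phi y <= r]).
Proof.
move=> u v t [Ku /= phiu] [Kv /= phiv] t01; split; first exact: vK.
have /andP[t0 t1] := t01; apply: phi_le => eps e0.
have hu := phi_near Ku e0; have hv := phi_near Kv e0; near=> N.
apply: (@le_trans _ _ (t * wsum w (fun i => `|X i - u| ^+ 2) N
   + (1 - t) * wsum w (fun i => `|X i - v| ^+ 2) N)).
  rewrite -!wsumZ -wsumD; apply: wsum_le => [i|i]; first exact: weight_pos.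
  have -> : X i - (t *: u + (1 - t) *: v) = t *: (X i - u) + (1 - t) *: (X i - v).
    by rewrite !scalerBr addrACA -scalerDl subrKC scale1r opprD.
  exact: norm_sqr_convex2.
have W0 := weight_ge0 weight_pos N.
have h1 : wsum w (fun i => `|X i - u| ^+ 2) N <= (r + eps) * \sum_(i < N) w i.
  apply: (@le_trans _ _ ((phi u + eps) * \sum_(i < N) w i)); first by near: N.
  by rewrite ler_wpM2r// lerD2r.
have h2 : wsum w (fun i => `|X i - v| ^+ 2) N <= (r + eps) * \sum_(i < N) w i.
  apply: (@le_trans _ _ ((phi v + eps) * \sum_(i < N) w i)); first by near: N.
  by rewrite ler_wpM2r// lerD2r.
have := ler_wpM2l t0 h1; have s0 : 0 <= 1 - t by rewrite subr_ge0.
have := ler_wpM2l s0 h2; lra.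
Unshelve. all: by end_near. Qed.

(** [X i] is asymptotically fixed by T^m, so its distance to T^m y is at most [k m] times its
    distance to [y], up to an error that vanishes in the mean. *)
Lemma phi_iter_le m y : (1 <= m)%N -> K y -> phi (iter m T y) <= k m ^+ 2 * phi y.
Proof.
move=> m1 Ky; have km := ltW (k_gt0 m1); have d0 := diam_ge0.
apply: phi_le => eps e0.
pose M := (k m ^+ 2 + 1) * 2; have M0 : 0 < M by rewrite mulr_gt0// ltr_pwDr// sqr_ge0.
have eM : 0 < eps / M by rewrite divr_gt0.
have e20 : 0 < eps / 2 by lra.
pose err i := (2 * k m * d + d) * `|X i - iter m T (X i)|.
have err0 : upper_null err.
  by apply: upper_nullZ (X_approx_iter m); rewrite addr_ge0// !mulr_ge0.
have h1 := phi_near Ky eM; have h2 := wsum_upper_null weight_pos weight_div err0 e20.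
near=> N.
apply: (@le_trans _ _ (k m ^+ 2 * wsum w (fun i => `|X i - y| ^+ 2) N + wsum w err N)).
  rewrite -wsumZ -wsumD; apply: wsum_le => [i|i]; first exact: weight_pos.
  set e := `|X i - iter m T (X i)|; set s := `|X i - y|.
  have ed : e <= d by apply: dK => //; exact: iterK.
  have sd : s <= d by exact: dK.
  have e_ge0 : 0 <= e by exact: normr_ge0.
  have s_ge0 : 0 <= s by exact: normr_ge0.
  have le1 : `|X i - iter m T y| <= k m * s + e.
    have := ler_distD (iter m T (X i)) (X i) (iter m T y).
    by have := nonexp m1 (XK i) Ky; rewrite -/s -/e; lra.
  have le2 : `|X i - iter m T y| ^+ 2 <= (k m * s + e) ^+ 2.
    by rewrite ler_pXn2r ?nnegrE// addr_ge0// mulr_ge0.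
  have le3 : e * (2 * (k m * s) + e) <= e * (2 * k m * d + d).
    rewrite ler_wpM2l ?normr_ge0//.
    have : k m * s <= k m * d by rewrite ler_wpM2l.
    lra.
  by move: le2 le3; rewrite /err -/e !expr2; lra.
have W0 := weight_ge0 weight_pos N.
have : wsum w (fun i => `|X i - y| ^+ 2) N <= (phi y + eps / M) * \sum_(i < N) w i by near: N.
have : wsum w err N <= eps / 2 * \sum_(i < N) w i by near: N.
move=> h3 /(ler_wpM2l (sqr_ge0 (k m))) h4.
have : k m ^+ 2 * (eps / M) <= eps / 2.
  rewrite mulrA ler_pdivrMr// /M; have : 0 <= eps * 1 by rewrite mulr1 ltW.
  lra.
move=> /(ler_wpM2r W0) h5; lra.
Unshelve. all: by end_near. Qed.

Lemma phi_iter_near y eps : K y -> 0 < eps ->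
  \forall m \near \oo, phi (iter m T y) <= phi y + eps.
Proof.
move=> Ky e0.
have cv : k m ^+ 2 * phi y @[m --> \oo] --> 1 ^+ 2 * phi y.
  by apply: cvgMl; apply: cvgM.
have lt : 1 ^+ 2 * phi y < phi y + eps by rewrite expr1n mul1r ltrDl.
have h : \forall m \near \oo, k m ^+ 2 * phi y <= phi y + eps.
  exact: (cvgr_le _ cv).
near=> m.
apply: (@le_trans _ _ (k m ^+ 2 * phi y)); last by near: m.
by apply: phi_iter_le => //; near: m; exact: nbhs_infty_ge.
Unshelve. all: by end_near. Qed.

(** * Consequences of minimality at a fixed point *)

Variable p : E.
Hypothesis Kp : K p.
Hypothesis Tp : T p = p.
Hypothesis p_min : forall y, K y -> phi p <= phi y.

Let v := f p - p.

Lemma iter_fixed m q : T q = q -> iter m T q = q.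
Proof. by move=> Tq; elim: m => //= m ->. Qed.

(** If the mean exceeded [eps] at all times from [N0] on, moving [p] to [p + t *: v], which is
    [t *: f p + (1 - t) *: p] and so in [K], would lower [phi] by [t * eps / 2]. *)
Lemma optimality eps (N0 : nat) : 0 < eps -> exists2 N, (N0 <= N)%N &
  wsum w (fun i => dirder (X i - p) v) N <= eps * \sum_(i < N) w i.
Proof.
move=> e0; apply: contrapT => none.
have gt N : (N0 <= N)%N -> eps * (\sum_(i < N) w i)
    < wsum w (fun i => dirder (X i - p) v) N.
  by move=> nN; rewrite ltNge; apply/negP => le; apply: none; exists N.
have e40 : 0 < eps / 4 by lra.
have [C C0 HC] := dirder_lip smooth v d e40.
have V0 := normr_ge0 v.
have D0 : 0 < C * `|v| + 1 by rewrite ltr_pwDr// mulr_ge0.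
pose t := Num.min 1 (eps / 4 / (C * `|v| + 1)).
have t0 : 0 < t by rewrite lt_min ltr01 divr_gt0.
have t1 : t <= 1 by rewrite ge_min lexx.
have te : C * (t * `|v|) <= eps / 4.
  have : t <= eps / 4 / (C * `|v| + 1) by rewrite ge_min lexx orbT.
  by rewrite ler_pdivlMr//; lra.
have Kq : K (p + t *: v).
  have -> : p + t *: v = t *: f p + (1 - t) *: p.
    by rewrite /v scalerBr scalerBl scale1r addrCA.
  by apply: vK; rewrite ?(ltW t0) ?t1//; exact: fK.
have pt i : `|X i - (p + t *: v)| ^+ 2
    <= `|X i - p| ^+ 2 + (- (2 * t)) * dirder (X i - p) v + t * eps.
  have := dirder_le (X i - (p + t *: v)) v t0; rewrite /sqnorm_quot.
  have zE : X i - (p + t *: v) + t *: v = X i - p by rewrite opprD addrA subrK.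
  rewrite zE ler_pdivlMr ?mulr_gt0// => h1.
  have := HC (X i - (p + t *: v)) (X i - p) (dK (XK i) Kq) (dK (XK i) Kp).
  have -> : X i - p - (X i - (p + t *: v)) = t *: v.
    by rewrite -{1}zE addrAC subrr add0r.
  rewrite normrZ gtr0_norm// => h2.
  have h3 : dirder (X i - p) v <= dirder (X i - (p + t *: v)) v + eps / 2 by lra.
  have := ler_wpM2l (ltW t0) h3; lra.
have te0 : 0 < t * eps / 2 by rewrite divr_gt0 ?mulr_gt0.
suff : phi (p + t *: v) <= phi p - t * eps / 2.
  by have := p_min Kq; lra.
apply: phi_le => e' e'0.
have h := phi_near Kp (addr_gt0 te0 e'0); near=> N.
have W0 := weight_ge0 weight_pos N.
apply: (@le_trans _ _ (wsum w (fun i => `|X i - p| ^+ 2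
    + (- (2 * t)) * dirder (X i - p) v + t * eps) N)).
  by apply: wsum_le => // i; exact: weight_pos.
rewrite !wsumD wsumZ wsum_cst.
have hN : wsum w (fun i => `|X i - p| ^+ 2) N
    <= (phi p + (t * eps / 2 + e')) * \sum_(i < N) w i by near: N.
have nN : (N0 <= N)%N by near: N; exact: nbhs_infty_ge.
have := ler_wpM2l (ltW t0) (ltW (gt N nN)); lra.
Unshelve. all: by end_near. Qed.

Let delta := 1 - alpha ^+ 2.

Lemma delta_gt0 : 0 < delta.
Proof.
have /andP[a0 a1] := alpha01; rewrite subr_gt0 expr2.
by apply: (@le_lt_trans _ _ alpha) => //; rewrite ler_piMl// ltW.
Qed.

Lemma halfc_gt0 i : 0 < 1 - c i / 2.
Proof. by have /andP[c0 c1] := c01 i; lra. Qed.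

Lemma halfcM_weight i : (1 - c i / 2) * w i = a i.
Proof. by rewrite /w mulrC divfK// gt_eqF// halfc_gt0. Qed.

Lemma weight_delta i : w i * delta <= 1.
Proof.
have /andP[a0 a1] := a01 i; have /andP[b0 b1] := b01 i; have /andP[c0 c1] := c01 i.
have h := halfc_gt0 i; rewrite /w mulrAC ler_pdivrMr// mul1r /delta.
have : 0 <= a i * alpha ^+ 2 by rewrite mulr_ge0 ?sqr_ge0// ltW.
have := abc i; lra.
Qed.

Lemma step_fixed i : `|X i.+1 - p| ^+ 2 <= (1 - w i * delta) * `|X i - p| ^+ 2
  + w i * (eta i * d ^+ 2 + 2 * dirder (X i.+1 - p) v).
Proof.
have /andP[a0 a1] := a01 i; have h := halfc_gt0 i.
have Ah : f (X i) - f p + v = f (X i) - p by rewrite addrA subrK.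
have pe : `|p - iter i.+1 T p| <= 0 by rewrite iter_fixed// subrr normr0.
have := step_le Kp Ah pe diam_ge0; rewrite mulr0 addr0.
have fle : `|f (X i) - f p| ^+ 2 <= alpha ^+ 2 * `|X i - p| ^+ 2.
  have /andP[al0 _] := alpha01.
  by rewrite -exprMn ler_pXn2r ?nnegrE ?mulr_ge0//; exact: f_contr.
have := ler_wpM2l (ltW a0) fle => h1 h2.
rewrite -(ler_pM2l h).
have -> : (1 - c i / 2) * ((1 - w i * delta) * `|X i - p| ^+ 2 +
   w i * (eta i * d ^+ 2 + 2 * dirder (X i.+1 - p) v))
   = (1 - c i / 2 - a i * delta) * `|X i - p| ^+ 2
     + a i * (eta i * d ^+ 2 + 2 * dirder (X i.+1 - p) v).
  by rewrite -halfcM_weight; ring.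
have -> : 1 - c i / 2 - a i * delta = b i + c i / 2 + a i * alpha ^+ 2.
  by rewrite /delta; have := abc i; lra.
lra.
Qed.

Lemma eta_null : upper_null (fun i => eta i * d ^+ 2).
Proof.
have := upper_nullZ (sqr_ge0 d) k_null; apply: upper_null_le.
by apply: nearW => i; rewrite mulrC.
Qed.

(** The recursion carries the duality term at [X i.+1] and [optimality] at [X i]; this reconciles
    the two indices. *)
Lemma dirder_step_null :
  upper_null (fun i => dirder (X i.+1 - p) v - dirder (X i - p) v).
Proof.
move=> eps e0; have e20 : 0 < eps / 2 by lra.
have [C C0 HC] := dirder_lip smooth v d e20.
have h := upper_nullZ C0 X_step_null e20; near=> i.
have : C * `|X i.+1 - X i| <= eps / 2 by near: i.
have := HC (X i - p) (X i.+1 - p) (dK (XK i) Kp) (dK (XK i.+1) Kp).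
by rewrite opprB addrA subrK; lra.
Unshelve. all: by end_near. Qed.

Lemma mean_sqdist_small eps (N0 : nat) : 0 < eps -> exists2 N, (N0 <= N)%N &
  wsum w (fun i => `|X i - p| ^+ 2) N <= eps * \sum_(i < N) w i.
Proof.
move=> e0; have dl := delta_gt0.
pose g i := eta i * d ^+ 2 + 2 * (dirder (X i.+1 - p) v - dirder (X i - p) v).
have g0 : upper_null g.
  by apply: upper_nullD; [exact: eta_null|apply: upper_nullZ => //; exact: dirder_step_null].
have e1 : 0 < delta * eps / 6 by rewrite divr_gt0// mulr_gt0.
have [N1 _ H1] := wsum_upper_null weight_pos weight_div g0 e1.
have [N2 _ H2] := weight_large weight_div (d ^+ 2) e1.
have [N NN le] := optimality (maxn N0 (maxn N1 N2)) e1.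
move: NN; rewrite !geq_max => /and3P[n0 n1 n2]; exists N => //.
have {H1} h1 : wsum w g N <= delta * eps / 6 * \sum_(i < N) w i by apply: H1.
have {H2} h2 : d ^+ 2 <= delta * eps / 6 * \sum_(i < N) w i by apply: H2.
have := @recursion_wsum _ w (fun i => `|X i - p| ^+ 2)
  (fun i => (- delta) * `|X i - p| ^+ 2 + (g i + 2 * dirder (X i - p) v)) N.
rewrite 2!wsumD 2!wsumZ => /(_ _)/wrap[].
  by move=> i; apply: (le_trans (step_fixed i)); rewrite /g; lra.
have /andP[_ X0] := sqdist_bound 0 Kp; have := sqr_ge0 `|X N - p| => XN hs.
have W0 := weight_ge0 weight_pos N; rewrite -(ler_pM2l dl).
have : 0 <= delta * eps / 6 * \sum_(i < N) w i by rewrite mulr_ge0// ltW.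
lra.
Qed.

(** The splitting [X i - q] plus [f (X i) - X i] gives |X i - q|^2 the coefficient a + b + c/2 = 1 -
    c/2, hence exactly 1 after division, so the sum telescopes. The factor 2 bounds 1 / (1 -
    c/2). *)
Lemma step_approx q i : K q -> `|X i.+1 - q| ^+ 2 <= `|X i - q| ^+ 2
  + w i * (eta i * d ^+ 2 + 2 * dirder (X i.+1 - q) (f (X i) - X i))
  + 2 * ((2 * L + 1) * d) * `|q - iter i.+1 T q|.
Proof.
move=> Kq; have /andP[a0 a1] := a01 i; have h := halfc_gt0 i.
have /andP[c0 c1] := c01 i.
have Ah : X i - q + (f (X i) - X i) = f (X i) - q by rewrite addrC addrA subrK.
have eD : `|q - iter i.+1 T q| <= d by apply: dK => //; exact: iterK.
have := step_le Kq Ah (lexx _) eD => hs.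
rewrite -(ler_pM2l h) 2!mulrDr [_ * (w i * _)]mulrA halfcM_weight.
have p0 : 0 <= (2 * L + 1) * d * `|q - iter i.+1 T q|.
  by rewrite !mulr_ge0 ?diam_ge0// addr_ge0// mulr_ge0 ?L_ge0.
have : 0 <= (1 - c i) * ((2 * L + 1) * d * `|q - iter i.+1 T q|).
  by rewrite mulr_ge0// subr_ge0 ltW.
have E1 : a i + (b i + c i / 2) = 1 - c i / 2 by have := abc i; lra.
rewrite -mulrDl E1 in hs; lra.
Qed.

(* Summing [step_approx] up to a time at which the weighted mean of [|X i - p|^2] is small, the direction [f (X i) - X i] can be replaced by [f p - p]. *)
Lemma dirder_approx_fixed (y : nat -> E) eps : (forall n, K (y n)) ->
  (forall m, upper_null (fun n => `|y n - iter m.+1 T (y n)|)) -> 0 < eps ->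
  \forall n \near \oo, - eps <= dirder (p - y n) v.
Proof.
move=> Ky yT e0; pose e1 := eps / 4; have e10 : 0 < e1 by rewrite divr_gt0.
have d0 := diam_ge0; have L0 := L_ge0.
have [C C0 HC] := dirder_lip smooth v d e10.
(* [H] collects the terms linear in |X i - p| from [f1] and [f2], doubled; [M] is the coefficient
   needed in [f3] to trade them for squares. *)
pose H := 4 * d + 2 * C; have H0 : 0 <= H by rewrite addr_ge0 ?mulr_ge0.
pose M := H ^+ 2 / (4 * e1).
have M0 : 0 <= M by rewrite divr_ge0 ?sqr_ge0// mulr_ge0// ltW.
pose g i := eta i * d ^+ 2 + 2 * C * `|X i.+1 - X i|.
have g0 : upper_null g.
  apply: upper_nullD; first exact: eta_null.
  by apply: upper_nullZ X_step_null; rewrite mulr_ge0.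
have eM : 0 < e1 / (M + 1) by rewrite divr_gt0// ltr_pwDr.
have [N1 _ H1] := wsum_upper_null weight_pos weight_div g0 e10.
have [N2 _ H2] := weight_large weight_div (d ^+ 2) e10.
have [N3 _ H3] := weight_gt0 weight_div.
have [N NN hX] := mean_sqdist_small (maxn N3 (maxn N1 N2)) eM.
move: NN; rewrite !geq_max => /and3P[n3 n1 n2].
have {H1} h1 : wsum w g N <= e1 * \sum_(i < N) w i by apply: H1.
have {H2} h2 : d ^+ 2 <= e1 * \sum_(i < N) w i by apply: H2.
have {H3} W0 : 0 < \sum_(i < N) w i by apply: H3.
have {hX} hX : M * wsum w (fun i => `|X i - p| ^+ 2) N <= e1 * \sum_(i < N) w i.
  apply: (le_trans (ler_wpM2l M0 hX)); rewrite mulrA ler_wpM2r ?(ltW W0)//.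
  rewrite mulrA ler_pdivrMr ?ltr_pwDr//; have := ltW e10; lra.
pose G := 2 * ((2 * L + 1) * d).
have G0 : 0 <= G by rewrite !mulr_ge0// addr_ge0// mulr_ge0.
have eW : 0 < e1 * \sum_(i < N) w i by rewrite mulr_gt0.
(* [N] is fixed here, so only finitely many iterates of [y n] occur and their total error vanishes
   as [n] grows. *)
have hn := upper_nullZ G0 (upper_null_sum (u := fun m n => `|y n - iter m.+1 T (y n)|) N yT) eW.
near=> n.
have he : G * (\sum_(i < N) `|y n - iter i.+1 T (y n)|) <= e1 * \sum_(i < N) w i by near: n.
move: (y n) (Ky n) he => q Kq he.
set J := dirder (p - q) v; have [J' J'E] : exists J', J' = 2 * J + 3 * e1 by eexists.
have step i : `|X i.+1 - q| ^+ 2 <= `|X i - q| ^+ 2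
    + w i * (J' + (M * `|X i - p| ^+ 2 + g i)) + G * `|q - iter i.+1 T q|.
  apply: (le_trans (step_approx i Kq)); rewrite lerD2r lerD2l ler_pM2l ?weight_pos//.
  have f1 : dirder (X i.+1 - q) (f (X i) - X i)
      <= dirder (X i.+1 - q) v + d * (2 * `|X i - p|).
    have -> : f (X i) - X i = v + ((f (X i) - f p) - (X i - p)).
      by rewrite /v opprB addrACA [f p + _]addrC subrK addKr.
    apply: (le_trans (dirderD _ _ _)); rewrite lerD2l.
    apply: (le_trans (dirder_le_norm _ _)); apply: ler_pM => //; first exact: dK.
    apply: (le_trans (ler_normB _ _)).
    have : `|f (X i) - f p| <= `|X i - p|.
      apply: (le_trans (f_contr (XK i) Kp)); rewrite ler_piMl//.
      by case/andP: alpha01 => _ /ltW.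
    lra.
  have f2 : dirder (X i.+1 - q) v <= J + e1 + C * (`|X i.+1 - X i| + `|X i - p|).
    apply: (le_trans (HC (p - q) _ (dK Kp Kq) (dK (XK _) Kq))); rewrite lerD2l.
    rewrite ler_wpM2l// opprB addrA subrK; exact: ler_distD.
  have f3 : H * `|X i - p| <= e1 + M * `|X i - p| ^+ 2.
    (* AM-GM *)
    have := sqr_ge0 (H * `|X i - p| - 2 * e1); rewrite /M.
    set s := `|X i - p| => hs; rewrite -subr_ge0.
    have -> : e1 + H ^+ 2 / (4 * e1) * s ^+ 2 - H * s
      = (H * s - 2 * e1) ^+ 2 / (4 * e1) by field; rewrite gt_eqF.
    by rewrite divr_ge0// mulr_ge0// ltW.
  rewrite J'E /g; rewrite /H in f3; lra.
have sum_le : `|X N - q| ^+ 2 <= `|X 0%N - q| ^+ 2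
    + wsum w (fun i => J' + (M * `|X i - p| ^+ 2 + g i)) N
    + G * (\sum_(i < N) `|q - iter i.+1 T q|).
  elim: (N) => [|j IH]; first by rewrite /wsum !big_ord0 mulr0 !addr0.
  by rewrite /wsum !big_ord_recr /= mulrDr; have := step j; rewrite /wsum in IH; lra.
have XN := sqr_ge0 `|X N - q|; have /andP[_ X0] := sqdist_bound 0 Kq.
move: sum_le; rewrite 2!wsumD wsumZ wsum_cst J'E => sum_le.
(* Three [e1] come from [J'], and one each from the initial term, the squares, [g] and the
   approximate fixed point errors. *)
have : 0 <= (2 * J + 7 * e1) * \sum_(i < N) w i by lra.
rewrite pmulr_lge0// /e1; lra.
Unshelve. all: by end_near. Qed.

Lemma iteration_cvg : X i @[i --> \oo] --> p.
Proof.
have J0 : upper_null (fun i => dirder (X i - p) v).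
  move=> eps e0; have h := dirder_approx_fixed XK (fun m => X_approx_iter m.+1) e0.
  by apply: filterS h => i; rewrite -opprB dirder_oppl dirderN// lerNl opprK.
have Jn : upper_null (fun i => eta i * d ^+ 2 + 2 * dirder (X i.+1 - p) v).
  by apply: upper_nullD; [exact: eta_null|apply: upper_nullZ => //; exact: ((upper_nullS _).2 J0)].
have := recursion_upper_null weight_pos weight_div delta_gt0 weight_delta
  (fun i => sqr_ge0 `|X i - p|) Jn step_fixed.
move=> Y0; apply/cvgrPdist_le => e e0; have e20 : 0 < e ^+ 2 by rewrite exprn_gt0.
have := Y0 _ e20; apply: filterS => i.
by rewrite ler_pXn2r ?nnegrE ?(ltW e0)// distrC.
Qed.

(** The constant sequence [q] in [dirder_approx_fixed] fixes the sign of [dirder (p - q) v];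
    domination of [g] by [dirder] transfers it to any duality functional. *)
Lemma variational_inequality q (g : E -> R) : K q -> T q = q ->
  duality_map (q - p) g -> 0 <= g (p - f p).
Proof.
move=> Kq Tq dg.
have Jp : 0 <= dirder (p - q) v.
  rewrite leNgt; apply/negP => Jlt.
  have e0 : 0 < - dirder (p - q) v / 2 by lra.
  have [|N _ HN] := @dirder_approx_fixed (fun=> q) _ (fun=> Kq) _ e0.
    by move=> m eps eps0; apply: nearW => n; rewrite iter_fixed// subrr normr0 ltW.
  by have := HN N (leqnn N); rewrite /=; lra.
have := duality_map_le_dirder v dg.
rewrite -(opprB p q) dirder_oppl dirderN// => gv.
have [glin _ _ _] := dg.
have g0 : g 0 = 0 by have := glin 1 0 0; rewrite scale1r add0r mul1r; lra.
have := glin (-1) v 0; rewrite addr0 g0 addr0 scaleN1r mulN1r /v opprB => ->.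
by rewrite -/v; lra.
Qed.

End ViscosityIteration.

(** Adding the two inequalities, tested on the derivative functionals, gives |q - p|^2 <= <f q - f
    p, J (q - p)> <= alpha |q - p|^2. *)
Lemma variational_inequality_unique (R : realType) (E : normedModType R)
    (K : set E) (f : E -> E) (alpha : R) (p q : E) :
  unif_gateaux_norm E -> alpha < 1 ->
  (forall y z, K y -> K z -> `|f y - f z| <= alpha * `|y - z|) -> K p -> K q ->
  (forall g, duality_map (q - p) g -> 0 <= g (p - f p)) ->
  (forall g, duality_map (p - q) g -> 0 <= g (q - f q)) -> q = p.
Proof.
move=> smooth a1 f_contr Kp Kq hp hq.
have h1 := hp _ (dirder_duality_map smooth (q - p)).
have := hq _ (dirder_duality_map smooth (p - q)).
rewrite -(opprB q p) dirder_oppl opprB => h2.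
have := dirder_linear smooth (q - p) 1 (p - f p) (f q - q).
rewrite scale1r mul1r.
have -> : p - f p + (f q - q) = (-1) *: (q - p) + (f q - f p).
  by rewrite scaleN1r opprB addrACA [RHS]addrACA [- f p + - q]addrC.
rewrite dirder_linear// dirder_self mulN1r => h3.
have := dirder_le_norm (q - p) (f q - f p).
have := ler_wpM2l (normr_ge0 (q - p)) (f_contr _ _ Kq Kp) => h4 h5.
have h6 : (1 - alpha) * `|q - p| ^+ 2 <= 0 by rewrite expr2 in h3 *; lra.
have {}h6 : `|q - p| ^+ 2 <= 0 by rewrite -(pmulr_rle0 _ (_ : 0 < 1 - alpha)) ?subr_gt0.
apply/eqP; rewrite -subr_eq0 -normr_eq0 -sqrf_eq0 eq_le h6 sqr_ge0//.
Qed.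


Theorem theorem1 (R : realType) (E : completeNormedModType R)
  (K : set E) (T f : E -> E) (k a b c : nat -> R) (alpha : R) (x : nat -> E) :
  unif_gateaux_norm E ->
  uniform_normal_structure E ->
  K !=set0 -> bounded_set K -> closed K -> convex_subset K ->
  (forall y, K y -> K (T y)) ->
  (forall n, (1 <= n)%N -> 0 < k n) ->
  k n @[n --> \oo] --> (1 : R) ->
  asymp_nonexpansive K T k ->
  sup [set r | exists n, (1 <= n)%N /\ r = k n]
    <= Num.sqrt (normal_structure_coef E) ->
  (exists z, K z /\ T z = z) ->
  (forall y, K y -> K (f y)) ->
  0 <= alpha < 1 ->
  (forall y z, K y -> K z -> `|f y - f z| <= alpha * `|y - z|) ->
  (forall n, (1 <= n)%N -> 0 < a n < 1) ->
  (forall n, (1 <= n)%N -> 0 <= b n < 1) ->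
  (forall n, (1 <= n)%N -> 0 < c n < 1) ->
  (forall n, (1 <= n)%N -> a n + b n + c n = 1) ->
  a n @[n --> \oo] --> (0 : R) ->
  (\sum_(1 <= i < n) a i) @[n --> \oo] --> +oo ->
  ((k n ^+ 2 - 1) / a n) @[n --> \oo] --> (0 : R) ->
  K (x 1%N) ->
  (forall n, (1 <= n)%N -> K (x n)) ->
  (forall n, (1 <= n)%N ->
     x n.+1 = a n *: f (x n) + b n *: x n
              + c n *: iter n T (2^-1 *: (x n + x n.+1))) ->
  `|x n - iter n T (x n)| @[n --> \oo] --> (0 : R) ->
  exists p : E,
    [/\ K p, T p = p, x n @[n --> \oo] --> p,
        (forall y, K y -> T y = y ->
           forall g, duality_map (y - p) g -> 0 <= g (p - f p))
      & (forall q, K q -> T q = q ->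
           (forall y, K y -> T y = y ->
              forall g, duality_map (y - q) g -> 0 <= g (q - f q)) ->
           q = p)].
Proof.
move=> smooth uns K0 bK cK vK TK k_gt0 k_cvg nonexp supk _ fK alpha01 f_contr
  a01 b01 c01 abc a_cvg a_div k_null _ xK x_rec x_approx.
pose N := normal_structure_coef E; pose L := Num.sqrt N.
have N1 : 1 < N by [].
have L1 : 1 < L by rewrite /L -sqrtr1 ltr_sqrt// (lt_trans ltr01).
have N0 : 0 < N := lt_trans ltr01 N1.
have L0 : 0 < L := lt_trans ltr01 L1.
have L2 : L ^+ 2 = N by rewrite sqr_sqrtr// ltW.
have k_le n : (1 <= n)%N -> k n <= L.
  move=> n1; apply: le_trans supk; apply: ub_le_sup; last by exists n.
  (* Convergence bounds [k], so that the real [sup] dominates each term. *)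
  have [M [_ HM]] := @cvg_seq_bounded _ _ k (cvgP _ k_cvg).
  exists (M + 1) => _ [m [_ ->]]; apply: (le_trans (ler_norm _)).
  by apply: (HM (M + 1)) => //; rewrite ltrDl.
have [d dK] : exists d, forall u v, K u -> K v -> `|u - v| <= d.
  have [M [_ HM]] := bK; exists ((M + 1) + (M + 1)) => u v Ku Kv.
  have MM : M < M + 1 by rewrite ltrDl.
  by rewrite (le_trans (ler_normB _ _))// lerD// (HM _ MM).
have Li0 : 0 < L^-1 by rewrite invr_gt0.
have Li1 : L^-1 < 1 by rewrite invf_lt1.
have NL : N^-1 < L^-1.
  by rewrite -L2 ltf_pV2 ?posrE ?exprn_gt0// expr2 ltr_pMr.
(* Any value strictly between [N^-1], for [chebyshev_point], and [L^-1], for [L * kappa < 1]; the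
   interval is nonempty because [N > 1]. *)
pose kappa := (N^-1 + L^-1) / 2.
have Ni0 : 0 < N^-1 by rewrite invr_gt0.
have kap1 : N^-1 < kappa by rewrite /kappa; lra.
have kap2 : kappa < L^-1 by rewrite /kappa; lra.
have kap01 : 0 <= kappa < 1 by rewrite /kappa; lra.
have Lk : L * kappa < 1 by rewrite -ltr_pdivlMl// mulr1.
have center (C : set E) (r : R) : closed C -> convex_subset C -> C !=set0 ->
    (forall u v, C u -> C v -> `|u - v| <= r) ->
    exists2 y, C y & forall z, C z -> `|y - z| <= kappa * r.
  exact: chebyshev_point.
pose X i := x i.+1; pose a' i := a i.+1; pose b' i := b i.+1; pose c' i := c i.+1.
have abs_null (u : nat -> R) : u n @[n --> \oo] --> (0 : R) -> upper_null (fun n => `|u n|).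
  by move=> u0; apply: cvg0_upper_null; rewrite -(normr0 R); exact: cvg_norm.
have a_null : upper_null a' := (upper_nullS a).2 (cvg0_upper_null a_cvg).
have a'_div : (\sum_(i < n) a' i) @[n --> \oo] --> +oo.
  apply/cvgryPge => A; have /cvgryPge/(_ A)[n0 _ Hn] := a_div.
  exists n0 => // n /= nn; have := Hn n.+1 (leq_trans nn (leqnSn n)).
  by rewrite /= big_add1 big_mkord.
(* [k] may drop below 1; the absolute value keeps this error term nonnegative. *)
have k'_null : upper_null (fun i => `|k i.+1 ^+ 2 - 1| / a' i).
  have := (upper_nullS _).2 (abs_null _ k_null); apply: upper_null_le.
  apply: nearW => i; have /andP[ai _] := a01 _ (ltn0Sn i).
  by rewrite normrM normfV (gtr0_norm ai).
have XK i : K (X i) by exact: xK.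
have X_rec i : X i.+1 = a' i *: f (X i) + b' i *: X i
    + c' i *: iter i.+1 T (2^-1 *: (X i + X i.+1)) by exact: x_rec.
have X_approx : upper_null (fun i => `|X i - iter i.+1 T (X i)|).
  exact: ((upper_nullS _).2 (cvg0_upper_null x_approx)).
have a'01 i : 0 < a' i < 1 by exact: a01.
have b'01 i : 0 <= b' i < 1 by exact: b01.
have c'01 i : 0 < c' i < 1 by exact: c01.
have abc' i : a' i + b' i + c' i = 1 by exact: abc.
have [||||p [Kp Tp p_min]] := @fixed_point_minimizer _ _ _ kap01 center K T k L d
  (phi a' c' X) cK vK K0 dK TK nonexp k_cvg k_le (ltW L1) Lk.
- by move=> r; exact: (phi_sublevel_closed cK dK a'01 c'01 a'_div XK).
- by move=> r; exact: (phi_sublevel_convex vK dK a'01 c'01 a'_div XK).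
- by move=> y; exact: (phi_ge0 dK a'01 c'01 a'_div XK).
- move=> y Ky eps; exact: (phi_iter_near vK dK TK k_gt0 k_cvg k_le nonexp fK
    a'01 c'01 abc' a_null a'_div XK X_rec X_approx Ky).
have vi y : K y -> T y = y -> forall g, duality_map (y - p) g -> 0 <= g (p - f p).
  move=> Ky Ty g; exact: (variational_inequality smooth vK dK TK k_gt0 k_cvg k_le
    nonexp fK alpha01 f_contr a'01 b'01 c'01 abc' a_null a'_div k'_null XK X_rec
    X_approx Kp Tp p_min Ky Ty).
exists p; split=> //.
- by rewrite -cvg_shiftS; exact: (iteration_cvg smooth vK dK TK k_gt0 k_cvg k_le
    nonexp fK alpha01 f_contr a'01 b'01 c'01 abc' a_null a'_div k'_null XK X_rec
    X_approx Kp Tp p_min).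
- move=> q Kq Tq hq; apply: (variational_inequality_unique smooth _ f_contr Kp Kq).
  + by case/andP: alpha01.
  + exact: vi.
  + exact: hq.
Qed.
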